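(* Let $(V,E)$ be a $k$-uniform hypergraph with $k$ even and $\#V=n$, and let $\alpha=\max\{\#U:\ U\subset V,\ U\text{ contains no hyperedge}\}$ be its independence number. Let $\lambda_i$ be the $i$-th min-max H-eigenvalue of the adjacency tensor of $(V,E)$, $i=1,\dots,n$. Then $$\alpha\le\min\{\#\{i:\lambda_i\le0\},\ \#\{i:\lambda_i\ge0\}\}.$$ Moreover, for any H-eigenvector $x$ corresponding to $\lambda_i$ whose multiplicity is $r$, the number of connected components of the support of $x$ is at most $\min\{i+r-1,\ n-i+r\}$.
   Context: An adjacency tensor of $(V,E)$, $V=\{1,\dots,n\}$, is a nonnegative symmetric tensor $A=(a_{i_1,\dots,i_k})$ of order $k$ and dimension $n$ with $a_{i_1,\dots,i_k}>0$ if and only if $\{i_1,\dots,i_k\}\in E$ (all hyperedges have exactly $k$ vertices). Let $D$ be a diagonal tensor with positive diagonal entries $d_1,\dots,d_n$. For a tensor $C$ write $Cx^{k-1}=\big(\sum_{i_2,\dots,i_k}c_{i,i_2,\dots,i_k}x_{i_2}\cdots x_{i_k}\big)_{i=1}^n$. H-eigenpairs (of $A$ with respect to $D$) are $(\lambda,x)$, $x\ne0$, with $Ax^{k-1}=\lambda Dx^{k-1}$; $x$ is an H-eigenvector. The $i$-th min-max H-eigenvalue is $$\lambda_i=\inf_{\mathrm{genus}(S)\ge i}\ \sup_{x\in S}\frac{\langle Ax^{k-1},x\rangle}{\langle Dx^{k-1},x\rangle},$$ with $S$ ranging over compact symmetric subsets of $\mathbb R^n\setminus\{0\}$; the genus of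 a nonempty symmetric set is the least $s\ge1$ such that it admits an odd continuous map to $\mathbb S^{s-1}$. The multiplicity of an eigenvalue is the genus of the set of its eigenvectors. The connected components of $\mathrm{supp}(x)$ are those of the graph on $\mathrm{supp}(x)$ in which two vertices are adjacent if some hyperedge contains both. *)

(* Defs.v *)
From HB Require Import structures.
From mathcomp Require Import all_boot all_order all_algebra.
From mathcomp Require Import all_classical all_reals all_analysis.
Import Order.TTheory GRing.Theory Num.Theory.
Import numFieldNormedType.Exports.

Set Implicit Arguments.
Unset Strict Implicit.
Unset Printing Implicit Defensive.

Local Open Scope classical_set_scope.
Local Open Scope ring_scope.

(* The vertex set {1, ..., n} is represented by 'I_n. *)

Definition uniform_hypergraph (n k : nat) (E : {set {set 'I_n}}) : Prop :=
  forall e, e \in E -> #|e| = k.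

Definition independent (n : nat) (E : {set {set 'I_n}}) (U : {set 'I_n}) :=
  [forall e in E, ~~ (e \subset U)].

Definition independence_number (n : nat) (E : {set {set 'I_n}}) : nat :=
  \max_(U : {set 'I_n} | independent E U) #|U|.

Definition tensor (R : realType) (k n : nat) := k.-tuple 'I_n -> R.

Definition symmetric_tensor (R : realType) (k n : nat) (C : tensor R k n) :=
  forall s t : k.-tuple 'I_n, perm_eq s t -> C s = C t.

Definition adjacency_tensor (R : realType) (k n : nat) (E : {set {set 'I_n}})
    (A : tensor R k n) : Prop :=
  [/\ forall t, 0 <= A t, symmetric_tensor A &
      forall t : k.-tuple 'I_n, 0 < A t <-> [set j in t]%SET \in E].

Definition positive_diagonal_tensor (R : realType) (k n : nat)
    (D : tensor R k n) : Prop :=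
  (forall t : k.-tuple 'I_n, ~~ constant t -> D t = 0) /\
  (forall i : 'I_n, 0 < D [tuple of nseq k i]).

(* The vector C x^(k-1): its i-th entry is the sum over all index tuples
   (i_1, i_2, ..., i_k) with i_1 = i. *)
Definition tensor_app (R : realType) (k n : nat) (C : tensor R k n)
    (x : 'rV[R]_n) : 'rV[R]_n :=
  \row_i \sum_(t : k.-tuple 'I_n | ohead t == Some i)
           C t * \prod_(j <- behead t) x ord0 j.

Definition dotv (R : realType) (n : nat) (x y : 'rV[R]_n) : R :=
  \sum_i x ord0 i * y ord0 i.

Definition rayleigh (R : realType) (k n : nat) (A D : tensor R k n)
    (x : 'rV[R]_n) : R :=
  dotv (tensor_app A x) x / dotv (tensor_app D x) x.

Definition H_eigenpair (R : realType) (k n : nat) (A D : tensor R k n)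
    (lam : R) (x : 'rV[R]_n) : Prop :=
  x != 0 /\ tensor_app A x = lam *: tensor_app D x.

Definition symmetric_set (R : realType) (n : nat) (S : set 'rV[R]_n) : Prop :=
  forall x, S x -> S (- x).

(* S admits an odd continuous map to the unit sphere of R^s. *)
Definition odd_map_to_sphere (R : realType) (n : nat) (S : set 'rV[R]_n)
    (s : nat) : Prop :=
  exists f : 'rV[R]_n -> 'rV[R]_s,
    [/\ {within S, continuous f},
        forall x, S x -> f (- x) = - f x &
        forall x, S x -> dotv (f x) (f x) = 1].

(* Used for nonempty symmetric sets only; +oo if there is no such s. *)
Definition genus (R : realType) (n : nat) (S : set 'rV[R]_n) : \bar R :=
  ereal_inf [set (s%:R)%:E | s in [set s | (0 < s)%N /\ odd_map_to_sphere S s]].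

(* The index i is 1-based. *)
Definition minmax_eigenvalue (R : realType) (k n : nat) (A D : tensor R k n)
    (i : nat) : \bar R :=
  ereal_inf [set ereal_sup [set (rayleigh A D x)%:E | x in S] |
    S in [set S : set 'rV[R]_n |
      [/\ S !=set0, compact S, symmetric_set S, ~ S 0 &
          ((i%:R)%:E <= genus S)%E]]].

Definition multiplicity (R : realType) (k n : nat) (A D : tensor R k n)
    (lam : R) : \bar R :=
  genus [set x | H_eigenpair A D lam x].

Definition supp (R : realType) (n : nat) (x : 'rV[R]_n) : {set 'I_n} :=
  [set i | x ord0 i != 0]%SET.

Definition supp_adj (R : realType) (n : nat) (E : {set {set 'I_n}})
    (x : 'rV[R]_n) : rel 'I_n :=
  fun u v => [&& u \in supp x, v \in supp x &
                 [exists e in E, (u \in e) && (v \in e)]].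

Definition nb_supp_components (R : realType) (n : nat) (E : {set {set 'I_n}})
    (x : 'rV[R]_n) : nat :=
  n_comp (supp_adj E x) (supp x).

(* Main.v *)
Require Import Defs.
From HB Require Import structures.
From mathcomp Require Import all_boot all_order all_algebra.
From mathcomp Require Import all_classical all_reals all_analysis.
From mathcomp Require Import ring lra zify.
Import Order.TTheory GRing.Theory Num.Theory.
Import numFieldNormedType.Exports.

(** Both parts rest on exhibiting linear subspaces W on which the form of
    A - lam D vanishes, and on comparing W with the competing sets of the
    min-max values by means of odd maps.

    For an independent set U, every monomial of A vanishes on the vectors
    supported in U, so with lam = 0 one may take W = R^U.  The sphere of W has
    genus #|U| (Borsuk-Ulam) and the Rayleigh quotient is 0 on it, whence
    lam_i <= 0 for i <= #|U|.  Any set of genus greater than n - #|U| meets W,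
    for otherwise the projection to the remaining coordinates would be a
    nonvanishing odd map to a space of dimension n - #|U|; whence lam_i >= 0 for
    i > n - #|U|.

    For an eigenvector x with c components of the support, W is spanned by the
    restrictions of x to these components: a hyperedge inside the support lies
    in one component, so a vector of W rescales each monomial of the eigenvector
    equation by a k-th power that depends on the component only
    ([component_rows_form]).  The two bounds on c are [isotropic_dim_upper] and
    [isotropic_dim_lower].  They replace the multiplicity theorem of
    Lusternik-Schnirelmann theory.  An odd map f from the eigenvectors to the
    unit sphere of R^r extends to the whole space by Tietze's theorem; where it
    vanishes there is no eigenvector, so one step along the negative gradient of
    the form of A - lam D decreases this form by a definite amount
    ([gradient_step_decrease]), and this step is odd because k is even.  If
    c >= i + r, applying the step to the zeros of f on the sphere of W produces a
    set of genus at least i with Rayleigh quotient bounded away below lam_i.  If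
    c > n - i + r, then on any set of genus at least i some zero of f is moved
    into W by the step, although the form is almost nonpositive before the step
    and zero on W.

    The Borsuk-Ulam theorem is proved combinatorially: Ky Fan's parity argument
    is applied to iterated barycentric subdivisions of the cross-polytope,
    viewed as formal chains mod 2 ([borsuk_ulam]). *)

Set Implicit Arguments.
Unset Strict Implicit.
Unset Printing Implicit Defensive.

Local Open Scope classical_set_scope.
Local Open Scope ring_scope.

(** * Formal chains modulo 2 *)

Section Chains.
Variable T : eqType.
Implicit Types (s : seq T) (c : seq (seq T)) (phi : seq T -> bool).

(** Simplices are lists of vertices, possibly with repetitions, and the facets
    are kept with multiplicity: no general position is ever required. *)
Fixpoint faces s : seq (seq T) :=
  if s is x :: s' then s' :: map (cons x) (faces s') else [::].

Definition boundary c : seq (seq T) := flatten (map faces c).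

(** The value of a mod 2 cochain on a chain. *)
Definition parity phi c : bool := \big[addb/false]_(s <- c) phi s.

(** Chains are compared as formal sums with coefficients in the field with two
    elements: only the parity of multiplicities is visible to cochains. *)
Definition eq_mod2 c c' : Prop := forall phi, parity phi c = parity phi c'.

Lemma parity_nil phi : parity phi [::] = false.
Proof. by rewrite /parity big_nil. Qed.

Lemma parity_cons phi s c : parity phi (s :: c) = phi s (+) parity phi c.
Proof. by rewrite /parity big_cons. Qed.

Lemma parity_cat phi c c' : parity phi (c ++ c') = parity phi c (+) parity phi c'.
Proof. by rewrite /parity big_cat. Qed.

Lemma parity_flatten_map (F : seq T -> seq (seq T)) phi c :
  parity phi (flatten (map F c)) = parity (fun s => parity phi (F s)) c.
Proof. by elim: c => [|s c IH] /=; rewrite ?parity_nil // parity_cat parity_cons IH. Qed.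

Lemma parity_addb phi psi c :
  parity (fun s => phi s (+) psi s) c = parity phi c (+) parity psi c.
Proof. exact: big_split. Qed.

Lemma eq_mod2_flatten_map (F : seq T -> seq (seq T)) c c' :
  eq_mod2 c c' -> eq_mod2 (flatten (map F c)) (flatten (map F c')).
Proof. by move=> cc' phi; rewrite !parity_flatten_map. Qed.

Lemma boundary_cat c c' : boundary (c ++ c') = boundary c ++ boundary c'.
Proof. by rewrite /boundary map_cat flatten_cat. Qed.

Lemma size_faces s t : t \in faces s -> size s = (size t).+1.
Proof.
elim: s t => [|x s IH] t //=; rewrite inE => /predU1P[->//|].
by case/mapP => u /IH -> ->.
Qed.

(** The facets of a cone x * s are s itself and the cones over the facets of
    s.  The empty simplex is allowed for s, so that chains are augmented and
    this formula holds without a special case for vertices. *)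
Lemma boundary_cone x c :
  eq_mod2 (boundary (map (cons x) c)) (c ++ map (cons x) (boundary c)).
Proof.
move=> phi; elim: c => [|s c IH] //=.
rewrite /boundary /= map_cat !parity_cons !parity_cat -/(boundary _) IH.
by rewrite parity_cat -/(boundary _); congr (_ (+) _); rewrite addbCA.
Qed.

(** A face of codimension 2 is obtained by deleting two vertices in either
    order, hence is counted twice. *)
Lemma boundary_faces s : eq_mod2 (boundary (faces s)) [::].
Proof.
elim: s => [|x s IH] phi //=.
rewrite /boundary /= parity_cat -/(boundary _) boundary_cone parity_cat.
rewrite addKb.
have := IH (fun t => phi (x :: t)).
by rewrite /parity big_map !big_nil.
Qed.

End Chains.

Lemma faces_map (T U : eqType) (f : T -> U) s :
  faces (map f s) = map (map f) (faces s).
Proof.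
elim: s => [|x s IH] //=; rewrite IH -!map_comp; congr (_ :: _).
Qed.

Lemma boundary_map (T U : eqType) (f : T -> U) c :
  boundary (map (map f) c) = map (map f) (boundary c).
Proof.
rewrite /boundary -!map_comp map_flatten -map_comp; congr flatten.
by apply: eq_map => s /=; rewrite faces_map.
Qed.

Lemma parity_map (T U : eqType) (f : T -> U) phi c :
  parity phi (map (map f) c) = parity (phi \o map f) c.
Proof. by rewrite /parity big_map. Qed.

(** * Barycentric subdivision of chains *)

Section Subdivision.
Variables (T : eqType) (bary : seq T -> T).
Implicit Types (s : seq T) (c : seq (seq T)).

(** The subdivision of s is the cone from the barycenter of s over the
    subdivided boundary of s; the recursion is on the number of vertices. *)
Fixpoint sd_fuel (m : nat) s : seq (seq T) :=
  match m with
  | 0 => [:: [::]]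
  | m'.+1 => map (cons (bary s)) (flatten (map (sd_fuel m') (faces s)))
  end.

Definition sd s := sd_fuel (size s) s.

Definition sd_chain c := flatten (map sd c).

Lemma sd_cons x s :
  sd (x :: s) = map (cons (bary (x :: s))) (sd_chain (faces (x :: s))).
Proof.
have -> : sd (x :: s) = map (cons (bary (x :: s)))
  (flatten (map (sd_fuel (size s)) (faces (x :: s)))) by [].
congr (map _ (flatten _)); apply/eq_in_map => t /size_faces [st].
by rewrite /sd -st.
Qed.

Lemma sd_chain_cat c c' : sd_chain (c ++ c') = sd_chain c ++ sd_chain c'.
Proof. by rewrite /sd_chain map_cat flatten_cat. Qed.

Lemma boundary_sd_chain_of c :
  (forall s, s \in c -> eq_mod2 (boundary (sd s)) (sd_chain (faces s))) ->
  eq_mod2 (boundary (sd_chain c)) (sd_chain (boundary c)).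
Proof.
move=> h phi; elim: c h => [|s c IH] h //.
rewrite /sd_chain /boundary /= !map_cat !flatten_cat !parity_cat IH; last first.
  by move=> t tc; apply: h; rewrite inE tc orbT.
by rewrite (h s _ phi) // mem_head.
Qed.

(** By induction on the dimension: the cone formula gives the subdivided
    boundary plus a cone over its boundary, and the latter is the cone over
    the subdivision of a double boundary, which vanishes mod 2. *)
Lemma boundary_sd s : eq_mod2 (boundary (sd s)) (sd_chain (faces s)).
Proof.
move: {2}(size s).+1 (ltnSn (size s)) => m; elim: m s => // m IH s sm.
case: s sm => [|x s] sm; first by [].
rewrite sd_cons => phi; rewrite boundary_cone parity_cat.
set X := sd_chain _.
have X0 : eq_mod2 (boundary X) [::].
  move=> psi; rewrite boundary_sd_chain_of; last first.
    move=> t /size_faces st; apply: IH.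
    by rewrite st ltnS in sm.
  by rewrite (eq_mod2_flatten_map _ (boundary_faces _)).
have := X0 (fun t => phi (bary (x :: s) :: t)).
rewrite /parity [in X in _ -> X]big_map => -> ; rewrite big_nil.
by rewrite addbF.
Qed.

Lemma boundary_sd_chain c :
  eq_mod2 (boundary (sd_chain c)) (sd_chain (boundary c)).
Proof. by apply: boundary_sd_chain_of => s _; apply: boundary_sd. Qed.

Lemma boundary_iter_sd N c :
  eq_mod2 (boundary (iter N sd_chain c)) (iter N sd_chain (boundary c)).
Proof.
elim: N => [|N IH] //= phi.
by rewrite boundary_sd_chain (eq_mod2_flatten_map _ IH).
Qed.

Lemma iter_sd_eq_mod2 N c c' :
  eq_mod2 c c' -> eq_mod2 (iter N sd_chain c) (iter N sd_chain c').
Proof. by elim: N => //= N IH h phi; rewrite (eq_mod2_flatten_map _ (IH h)). Qed.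

Lemma iter_sd_cat N c c' :
  iter N sd_chain (c ++ c') = iter N sd_chain c ++ iter N sd_chain c'.
Proof. by elim: N => //= N ->; rewrite sd_chain_cat. Qed.

Section SdMap.
Variable f : T -> T.
Hypothesis bary_f : forall s, bary (map f s) = f (bary s).

(** Naturality; it is used with the antipode, so that the subdivision of the
    antipodal chain is the antipodal chain of the subdivision. *)
Lemma sd_map s : sd (map f s) = map (map f) (sd s).
Proof.
rewrite /sd size_map; move: (size s) => m; elim: m s => [|m IH] s //=.
rewrite bary_f faces_map !map_flatten -!map_comp; congr flatten; apply: eq_map => t /=.
by rewrite IH -!map_comp.
Qed.

Lemma iter_sd_map N c :
  iter N sd_chain (map (map f) c) = map (map f) (iter N sd_chain c).
Proof.
elim: N => //= N ->; rewrite /sd_chain map_flatten -!map_comp; congr flatten.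
by apply: eq_map => s /=; rewrite sd_map.
Qed.
End SdMap.

End Subdivision.

(** * Ky Fan's parity lemma *)

Lemma parity_all_false (T : eqType) (phi : seq T -> bool) c :
  (forall s, s \in c -> ~~ phi s) -> parity phi c = false.
Proof. by move=> h; rewrite /parity big_seq big1 // => s /h /negbTE. Qed.

Lemma eq_in_parity (T : eqType) (phi psi : seq T -> bool) c :
  (forall s, s \in c -> phi s = psi s) -> parity phi c = parity psi c.
Proof. by move=> h; rewrite /parity big_seq [RHS]big_seq; apply: eq_bigr. Qed.

Lemma mem_faces (T : eqType) (s t : seq T) x : t \in faces s -> x \in t -> x \in s.
Proof.
elim: s t => [|y s IH] t //; rewrite [faces _]/= inE => /predU1P[->|/mapP[u us ->]].
  by move=> ->; rewrite orbT.
by rewrite !in_cons => /predU1P[->|/(IH u us) ->]; rewrite ?eqxx ?orbT.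
Qed.

Definition index_le : rel (nat * bool) := fun x y => (x.1 <= y.1)%N.
Definition index_lt : rel (nat * bool) := fun x y => (x.1 < y.1)%N.

Fixpoint sign_alternating (b : bool) (L : seq (nat * bool)) :=
  if L is x :: L' then (x.2 == b) && sign_alternating (~~ b) L' else true.

(** Strictly increasing coordinates with alternating signs, starting with the
    sign b. *)
Definition alternating b L := sign_alternating b L && sorted index_lt L.

(** Labels are pairs (coordinate, sign).  A simplex is consistent when it has
    no two vertices with the same coordinate and opposite signs, i.e. no
    complementary edge in the sense of Tucker's lemma. *)
Definition consistent (L : seq (nat * bool)) :=
  forall x y, x \in L -> y \in L -> x.1 = y.1 -> x = y.

Lemma alternating_cons b x L : (forall z, z \in L -> index_lt x z) ->
  alternating b (x :: L) = (x.2 == b) && alternating (~~ b) L.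
Proof.
rewrite /alternating /= -andbA; case: L => [|y L] //= h.
by rewrite h ?mem_head.
Qed.

Lemma alternating_dup b x L : alternating b (x :: x :: L) = false.
Proof. by rewrite /alternating /= /index_lt ltnn !andbF. Qed.

(** If two consecutive labels coincide, the two facets that delete one of them
    are equal and all the others keep the repetition, so everything cancels.
    Otherwise, look at the first label x: deleting it leaves the alternation
    of the tail, and the facets that keep x are governed by induction. *)
Lemma parity_faces_sorted b L : sorted index_le L -> consistent L ->
  parity (alternating b) (faces L) = alternating b L (+) alternating (~~ b) L.
Proof.
elim: L b => [|x [|y L] IH] b sL cL; first by rewrite parity_nil.
  by rewrite /= parity_cons parity_nil /alternating /=; case: x.2; case: b.
have cL' : consistent (y :: L).
  by move=> u v uL vL; apply: cL; rewrite inE ?uL ?vL orbT.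
have /andP[xy sL'] : index_le x y && sorted index_le (y :: L) by [].
have -> : faces (x :: y :: L) = (y :: L) :: map (cons x) (faces (y :: L)) by [].
rewrite parity_cons.
have [xyl|] := boolP (index_lt x y).
  have lex z : z \in y :: L -> index_lt x z.
    rewrite inE => /predU1P[->//|zL].
    have leLT : transitive index_le by move=> a u v; apply: leq_trans.
    have /allP /(_ _ zL) : all (index_le y) L by apply: order_path_min sL'.
    by apply: leq_trans.
  have -> : parity (alternating b) (map (cons x) (faces (y :: L))) =
      (x.2 == b) && parity (alternating (~~ b)) (faces (y :: L)).
    rewrite {1}/parity big_map.
    transitivity (parity (fun t => (x.2 == b) && alternating (~~ b) t)
                         (faces (y :: L))).
      apply: eq_in_parity => t tL; apply: alternating_cons => z zt.
      exact: lex (mem_faces tL zt).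
    case: (x.2 == b) => //=; by apply: parity_all_false.
  rewrite IH // !(alternating_cons _ lex) !negbK.
  by move: (alternating b (y :: L)) (alternating (~~ b) (y :: L)) => [] [];
     case: x.2; case: b.
rewrite -leqNgt => yx.
have -> : y = x.
  by apply: cL; rewrite ?mem_head // ?inE ?eqxx ?orbT //; apply/eqP; rewrite eqn_leq yx.
rewrite !alternating_dup [faces _]/= map_cons parity_cons addbA addbb.
rewrite parity_all_false // => s /mapP[t /mapP[u _ ->] ->].
by rewrite alternating_dup.
Qed.

(** For a cochain invariant under permutations of the vertices, deleting the
    i-th vertex may be replaced by removing the first occurrence of the
    vertex; the sum becomes a sum over the multiset of vertices. *)
Lemma parity_faces_rem (T : eqType) (phi : seq T -> bool) (s : seq T) :
  (forall t u, perm_eq t u -> t \in faces s -> phi t = phi u) ->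
  parity phi (faces s) = \big[addb/false]_(x <- s) phi (rem x s).
Proof.
elim: s phi => [|x s IH] phi h; first by rewrite parity_nil big_nil.
rewrite [faces _]/= parity_cons big_cons [rem x _]/= eqxx; congr (_ (+) _).
have := IH (fun t => phi (x :: t)).
rewrite /parity big_map => ->; last first.
  move=> t u tu ts; apply: h; first by rewrite perm_cons.
  by rewrite inE map_f ?orbT.
rewrite big_seq [RHS]big_seq; apply: eq_bigr => y ys.
apply/esym; case: (eqVneq x y) => [->|xy]; last by rewrite /= (negbTE xy).
rewrite [rem y _]/= eqxx; apply: h; last by rewrite mem_head.
exact: perm_to_rem.
Qed.

Lemma consistent_perm L L' : perm_eq L L' -> consistent L -> consistent L'.
Proof. by move=> /perm_mem LL' c x y; rewrite -!LL'; apply: c. Qed.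

(** On a consistent list, the comparison of coordinates is antisymmetric, so
    the sorted list depends on the multiset only. *)
Lemma sort_consistent L L' : consistent L -> perm_eq L L' ->
  sort index_le L = sort index_le L'.
Proof.
move=> c LL'; apply/perm_sort_inP => //.
- by move=> x y _ _; exact: leq_total.
- by move=> x y z _ _ _; apply: leq_trans.
- by move=> x y xL yL h; apply: c => //; apply/eqP; rewrite eqn_leq.
Qed.

(** The cochain that recognizes the simplices whose labels, taken in the order
    of the coordinates, alternate in sign. *)
Definition ky_fan b L := alternating b (sort index_le L).

Lemma consistent_faces L t : consistent L -> t \in faces L -> consistent t.
Proof. by move=> c tL x y /(mem_faces tL) xL /(mem_faces tL) yL; apply: c. Qed.

(** Ky Fan's lemma for one simplex.  The vertices come in no particular order,
    so the labels are sorted first; the right-hand side is symmetric in the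
    two signs, hence independent of b. *)
Lemma ky_fan_facets b L : consistent L ->
  parity (ky_fan b) (faces L) = ky_fan true L (+) ky_fan false L.
Proof.
move=> c; set L' := sort index_le L.
have LL' : perm_eq L L' by rewrite perm_sym perm_sort.
have c' : consistent L' by exact: consistent_perm c.
have H M : consistent M -> forall t u, perm_eq t u -> t \in faces M ->
    ky_fan b t = ky_fan b u.
  move=> cM t u tu tM; rewrite /ky_fan (sort_consistent _ tu) //.
  exact: consistent_faces tM.
rewrite (parity_faces_rem (H _ c)) (perm_big _ LL') /=.
transitivity (\big[addb/false]_(x <- L') ky_fan b (rem x L')).
  rewrite big_seq [RHS]big_seq; apply: eq_bigr => x xL'; rewrite /ky_fan.
  suff -> : sort index_le (rem x L) = sort index_le (rem x L') by [].
  apply: sort_consistent; last first.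
    have xL : x \in L by rewrite (perm_mem LL').
    rewrite -(perm_cons x); apply: perm_trans (perm_to_rem xL').
    by apply: perm_trans LL'; rewrite perm_sym perm_to_rem.
  by move=> u v /mem_rem uL /mem_rem vL; apply: c.
rewrite -(parity_faces_rem (H _ c')).
have leLtot : total index_le by move=> u v; exact: leq_total.
have leLtr : transitive index_le by move=> u v w; exact: leq_trans.
have sL' : sorted index_le L' by exact: sort_sorted.
transitivity (parity (alternating b) (faces L')); last first.
  by rewrite parity_faces_sorted // /ky_fan -/L'; case: (b); rewrite // addbC.
apply: eq_in_parity => t tL'; rewrite /ky_fan sorted_sort //.
have sub : subseq t L'.
  elim: (L') t tL' => [|y s IH] t //=; rewrite inE => /predU1P[->|/mapP[u us ->]].
    exact: subseq_cons.
  by rewrite /= eqxx IH.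
exact: subseq_sorted sub sL'.
Qed.

Definition flip_sign (x : nat * bool) := (x.1, ~~ x.2).

Lemma ky_fan_flip b L : ky_fan b (map flip_sign L) = ky_fan (~~ b) L.
Proof.
rewrite /ky_fan sort_map.
have -> : sort (relpre flip_sign index_le) L = sort index_le L by [].
elim: (sort index_le L) b => [|x s IH] b //.
have aux c s' : sign_alternating c (map flip_sign s') = sign_alternating (~~ c) s'.
  elim: s' c => [|y s' IHs] c //=; rewrite IHs; congr (_ && _).
  by case: y.2; case: c.
by rewrite /alternating aux sorted_map.
Qed.

(** Alternating simplices have distinct coordinates among 0, ..., m - 1; this
    is where the dimension of the target enters. *)
Lemma ky_fan_size b m L : (forall x, x \in L -> (x.1 < m)%N) -> (m < size L)%N ->
  ky_fan b L = false.
Proof.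
move=> Lm mL; apply/negP => /andP[_ sL].
have : uniq (map fst (sort index_le L)).
  apply: (@sorted_uniq _ ltn); [exact: ltn_trans | exact: ltnn |].
  by rewrite sorted_map.
move=> /uniq_leq_size /(_ (_ : {subset _ <= iota 0 m})).
rewrite size_map size_sort size_iota leqNgt mL => /(_ _)/wrap[] //.
by move=> _ /mapP[x xL ->]; rewrite mem_iota /= add0n Lm // -(mem_sort index_le).
Qed.

(** * Convexity and mesh under subdivision *)

Section Barycenter.
Context {R : realType} {V : normedModType R}.
Implicit Types (s t : seq V) (u v w p : V).

Definition bary s : V := (size s)%:R^-1 *: \sum_(v <- s) v.

Lemma bary_opp s : bary (map -%R s) = - bary s.
Proof. by rewrite /bary size_map big_map sumrN scalerN. Qed.

Lemma bary_sub s p : s != [::] ->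
  bary s - p = (size s)%:R^-1 *: \sum_(w <- s) (w - p).
Proof.
move=> s0; have sz : (size s)%:R != 0 :> R by rewrite pnatr_eq0 size_eq0.
rewrite big_split /= big_const_seq count_predT iter_addr addr0 scalerDr.
by rewrite mulNrn scalerN -[p *+ _]scaler_nat scalerA mulVf // scale1r.
Qed.

(** A weak form of convexity, which is all that barycentric subdivision needs. *)
Definition mean_closed (Q : V -> Prop) :=
  forall s, s != [::] -> (forall v, v \in s -> Q v) -> Q (bary s).

Lemma mean_closed_ball p (r : R) : mean_closed (fun v => `|p - v| <= r).
Proof.
move=> s s0 h; have sz : 0 < (size s)%:R :> R by rewrite ltr0n lt0n size_eq0.
rewrite distrC bary_sub // normrZ ger0_norm ?invr_ge0 ?(ltW sz) //.
rewrite ler_pdivrMl //; apply: le_trans (ler_norm_sum _ _ _) _.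
apply: (@le_trans _ _ (\sum_(v <- s) r)).
  by rewrite big_seq [leRHS]big_seq; apply: ler_sum => v vs; rewrite distrC h.
by rewrite big_const_seq count_predT iter_addr addr0 mulr_natl.
Qed.

Lemma sd_mean_closed Q s t : mean_closed Q -> (forall v, v \in s -> Q v) ->
  t \in sd bary s -> forall v, v \in t -> Q v.
Proof.
move=> mQ; move: {2}(size s).+1 (ltnSn (size s)) => m.
elim: m s t => // m IH [|x s] t sm hQ.
  by rewrite /sd /= inE => /eqP-> v.
rewrite sd_cons => /mapP[t' /flattenP[c /mapP[s' s's ->] t's'] ->] v.
rewrite inE => /predU1P[->|vt']; first exact: mQ.
have ss' := size_faces s's.
apply: (IH s' t') => //; first by rewrite ss' ltnS in sm.
by move=> w ws'; apply: hQ; exact: mem_faces s's ws'.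
Qed.

Lemma sd_size s t : t \in sd bary s -> size t = size s.
Proof.
move: {2}(size s).+1 (ltnSn (size s)) => m.
elim: m s t => // m IH [|x s] t sm; first by rewrite /sd /= inE => /eqP->.
rewrite sd_cons => /mapP[t' /flattenP[c /mapP[s' s's ->] t's'] ->].
have ss' := size_faces s's.
rewrite ss'; congr _.+1; apply: IH t's'.
by rewrite ss' ltnS in sm.
Qed.

Definition mesh_le (rho : R) s := forall u v, u \in s -> v \in s -> `|u - v| <= rho.

Lemma bary_dist s (rho : R) v : mesh_le rho s -> v \in s ->
  `|bary s - v| <= (size s).-1%:R / (size s)%:R * rho.
Proof.
move=> sm vs.
have s0 : s != [::] by apply: contraTneq vs => ->.
have sz : 0 < (size s)%:R :> R by rewrite ltr0n lt0n size_eq0.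
rewrite bary_sub // normrZ ger0_norm ?invr_ge0 ?(ltW sz) //.
rewrite [leRHS]mulrAC [leRHS]mulrC ler_pM2l ?invr_gt0 //.
rewrite (perm_big _ (perm_to_rem vs)) /= big_cons subrr add0r.
apply: le_trans (ler_norm_sum _ _ _) _.
apply: (@le_trans _ _ (\sum_(w <- rem v s) rho)).
  by rewrite big_seq [leRHS]big_seq; apply: ler_sum => w /mem_rem ws; apply: sm.
by rewrite big_const_seq count_predT iter_addr addr0 size_rem // mulr_natl.
Qed.

(** The barycenter of s is within (size s - 1) / size s times the mesh from
    the vertices of s, hence, balls being convex, from all the vertices of
    the subdivision; two vertices that both lie in a subdivided facet are
    handled by induction.  The ratio m / (m + 1) is uniform over the faces. *)
Lemma sd_mesh_le m (rho : R) s t : (size s <= m.+1)%N -> 0 <= rho -> mesh_le rho s ->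
  t \in sd bary s -> mesh_le (m%:R / m.+1%:R * rho) t.
Proof.
move: {2}(size s).+1 (ltnSn (size s)) => l.
elim: l s t => // l IH [|x s] t sl sm r0 hs.
  by rewrite /sd /= inE => /eqP-> u v.
set q := m%:R / m.+1%:R * rho.
have q0 : 0 <= q by rewrite mulr_ge0 // divr_ge0.
rewrite sd_cons => /mapP[t' /flattenP[c /mapP[s' s's ->] t's'] ->].
have ss' := size_faces s's.
have bt v : v \in t' -> `|bary (x :: s) - v| <= q.
  have : mean_closed (fun v => `|bary (x :: s) - v| <= q) by exact: mean_closed_ball.
  move=> /sd_mean_closed; apply; last exact: t's'.
  move=> w ws'; apply: le_trans (bary_dist hs (mem_faces s's ws')) _.
  rewrite ler_wpM2r // ler_pdivrMr // mulrAC ler_pdivlMr //= -!natrM ler_nat.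
  move: sm; rewrite /= ltnS => sm.
  by rewrite mulnS [leqRHS]mulnS [(_ * m)%N]mulnC leq_add2r.
have st' : mesh_le q t'.
  apply: (IH s') => //; first by rewrite ss' ltnS in sl.
    by rewrite ss' ltnS in sm; apply: leq_trans sm _.
  by move=> u v us vs; apply: hs; exact: mem_faces s's _.
move=> u v; rewrite !inE => /predU1P[->|ut] /predU1P[->|vt].
- by rewrite subrr normr0.
- exact: bt.
- by rewrite distrC bt.
- exact: st'.
Qed.

Lemma sd_chain_ind (Pr Pr' : seq V -> Prop) c :
  (forall s t, Pr s -> t \in sd bary s -> Pr' t) ->
  (forall s, s \in c -> Pr s) -> forall t, t \in sd_chain bary c -> Pr' t.
Proof. by move=> h hc t /flattenP[d /mapP[s sc ->]]; apply: h; apply: hc. Qed.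

Lemma iter_sd_mean_closed (I : Type) (Q : I -> V -> Prop) N c :
  (forall i, mean_closed (Q i)) ->
  (forall s, s \in c -> exists i, forall v, v \in s -> Q i v) ->
  forall t, t \in iter N (sd_chain bary) c -> exists i, forall v, v \in t -> Q i v.
Proof.
move=> mQ hc; elim: N => [|N IH] //=.
apply: (sd_chain_ind _ IH) => s t [i hi] ts; exists i.
exact: sd_mean_closed ts.
Qed.

Lemma iter_sd_size m N c : (forall s, s \in c -> size s = m) ->
  forall t, t \in iter N (sd_chain bary) c -> size t = m.
Proof.
move=> hc; elim: N => [|N IH] //=.
by apply: (sd_chain_ind _ IH) => s t <- /sd_size.
Qed.

Lemma iter_sd_mesh_le l m (rho : R) N c : (l <= m.+1)%N -> 0 <= rho ->
  (forall s, s \in c -> size s = l) -> (forall s, s \in c -> mesh_le rho s) ->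
  forall t, t \in iter N (sd_chain bary) c -> mesh_le ((m%:R / m.+1%:R) ^+ N * rho) t.
Proof.
move=> lm r0 hs hc; elim: N => [|N IH]; first by rewrite expr0 mul1r.
rewrite exprS -mulrA iterS.
move=> t /flattenP[d /mapP[s sc ->]]; apply: sd_mesh_le.
- by rewrite (iter_sd_size hs sc).
- by rewrite mulr_ge0 // exprn_ge0 // divr_ge0.
- exact: IH.
Qed.

End Barycenter.

(** * Continuity and norms of row vectors *)

Section WithinContinuity.
Context {R : realType} {V W : normedModType R}.

Lemma within_continuousP (A : set V) (f : V -> W) :
  {within A, continuous f} <->
  forall x, A x -> forall e, 0 < e ->
    exists2 d : R, 0 < d & forall y, A y -> `|x - y| < d -> `|f x - f y| < e.
Proof.
rewrite subspace_continuousP; split=> h x Ax.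
  move=> e e0; have /cvgrPdist_lt /(_ e e0) := h x Ax.
  rewrite near_withinE => /nbhs_ballP[d /= d0 dP]; exists d => // y Ay xy.
  by apply: dP => //; rewrite -ball_normE.
apply/cvgrPdist_lt => e e0; have [d d0 dP] := h x Ax e e0.
rewrite near_withinE; apply/nbhs_ballP; exists d => //= y.
rewrite -ball_normE /= => xy Ay.
exact: dP.
Qed.

(** Heine-Cantor, for a map that is continuous on the compact set only. *)
Lemma compact_unif_continuous (A : set V) (f : V -> W) : compact A ->
  {within A, continuous f} -> forall e, 0 < e ->
  exists2 d : R, 0 < d &
    forall x y, A x -> A y -> `|x - y| < d -> `|f x - f y| < e.
Proof.
move=> cA /within_continuousP cf e e0.
have := cA; rewrite compact_near_coveringP -near_covering_withinP.
move=> /(_ _ (0^'+) (fun d x => forall y, A y -> `|x - y| < d -> `|f x - f y| < e)).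
move=> /(_ _ _)/wrap[].
  move=> x Ax; have [d d0 dP] := cf x Ax (e / 2) (divr_gt0 e0 (ltr0Sn _ 1)).
  exists (ball x (d / 2), [set t : R | t < d / 2]) => /=.
    split; first by apply: nbhsx_ballx; exact: divr_gt0.
    by apply: nbhs_right_lt; exact: divr_gt0.
  move=> [u t] [/= xu td] Au y Ay uy; rewrite -ball_normE /= in xu.
  rewrite [e]splitr -(subrK (f x) (f u)) -addrA.
  apply: le_lt_trans (ler_normD _ _) _; apply: ltrD.
    rewrite distrC; apply: dP => //; apply: lt_le_trans xu _.
    by rewrite ler_pdivrMr // ler_peMr ?ler1n // ltW.
  apply: dP => //; rewrite [d]splitr -(subrK u x) -addrA.
  by apply: le_lt_trans (ler_normD _ _) _; apply: ltrD => //; exact: lt_trans td.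
move=> hn.
have [d [d0 dP]] : exists d : R, 0 < d /\
    A `<=` (fun x => forall y, A y -> `|x - y| < d -> `|f x - f y| < e).
  near (0 : R)^'+ => d; exists d; split; first by near: d; exact: nbhs_right_gt.
  near: d; exact: hn.
by exists d => // x y Ax Ay; apply: dP.
Unshelve. all: by end_near. Qed.

End WithinContinuity.

Lemma continuous_sum {R : realType} {V : topologicalType} (I : Type) (r : seq I)
    (P : pred I) (f : I -> V -> R) :
  (forall i, continuous (f i)) -> continuous (fun x => \sum_(i <- r | P i) f i x).
Proof.
by move=> cf x; apply: cvg_big => [|i _]; [exact: add_continuous | exact: cf].
Qed.

Lemma continuous_prod {R : realType} {V : topologicalType} (I : Type) (r : seq I)
    (P : pred I) (f : I -> V -> R) :
  (forall i, continuous (f i)) -> continuous (fun x => \prod_(i <- r | P i) f i x).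
Proof.
by move=> cf x; apply: cvg_big => [|i _]; [exact: mul_continuous | exact: cf].
Qed.

Section CoordinateNorms.
Context {R : realType} {n : nat}.
Implicit Types (x y : 'rV[R]_n).

Lemma coord_norm x i : `|x ord0 i| <= `|x|.
Proof.
rewrite [leRHS]/Num.norm /= mx_normrE; apply/bigmax_geP; right => /=.
by exists (ord0, i); rewrite ?mem_index_enum.
Qed.

Lemma norm_coord_le x (r : R) : 0 <= r -> (forall i, `|x ord0 i| <= r) -> `|x| <= r.
Proof.
move=> r0 h; rewrite [leLHS]/Num.norm /= mx_normrE.
by apply/bigmax_leP; split => // -[i j] _ /=; rewrite ord1.
Qed.

Lemma norm_attained x : x != 0 -> exists i, `|x ord0 i| = `|x|.
Proof.
rewrite -normr_eq0 => /mx_norm_neq0[[i j] /= h].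
by exists j; rewrite ord1 in h; exact/esym/h.
Qed.

End CoordinateNorms.

(** The modulus of continuity is the least of those of the coordinates. *)
Lemma within_continuous_row {R : realType} {V : normedModType R} {n} (A : set V)
  (f : V -> 'rV[R]_n) :
  (forall i, {within A, continuous (fun x => f x ord0 i)}) -> {within A, continuous f}.
Proof.
move=> h; apply/within_continuousP => x Ax e e0.
have H i : {d : R | 0 < d & forall y, A y -> `|x - y| < d ->
     `|f x ord0 i - f y ord0 i| < e / 2}.
  apply: cid2; move/within_continuousP: (h i).
  by move=> /(_ x Ax _ (divr_gt0 e0 (ltr0Sn _ 1))).
exists (\big[Order.min/1]_i s2val (H i)).
  by elim/big_ind: _ => // [a b a0 b0|i _]; [rewrite lt_min a0 | case: (H i)].
move=> y Ay xy; apply: (@le_lt_trans _ _ (e / 2)); last first.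
  by rewrite ltr_pdivrMr // ltr_pMr ?ltr1n.
apply: norm_coord_le; first by apply: ltW; exact: divr_gt0.
move=> i; rewrite !mxE.
have := bigmin_le_cond 1 (fun i => s2val (H i)) (isT : xpredT i).
case: (H i) => d /= d0 dP xd.
by apply/ltW/dP => //; apply: lt_le_trans xy xd.
Qed.

(** * Labelling nonzero vectors by a dominant coordinate *)

Section Labels.
Context {R : realType} {m : nat}.
Implicit Types (y z : 'rV[R]_m).

(** The default value is reached only for the zero vector in dimension 0. *)
Definition label y : nat * bool :=
  if [pick j | `|y ord0 j| == `|y|] is Some j then (val j, 0 < y ord0 j) else (0%N, true).

Lemma labelP y : y != 0 ->
  exists2 j : 'I_m, `|y ord0 j| = `|y| & label y = (val j, 0 < y ord0 j).
Proof.
move=> y0; rewrite /label; case: pickP => [j /eqP jy|h]; first by exists j.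
by have [i hi] := norm_attained y0; have := h i; rewrite hi eqxx.
Qed.

Lemma label_opp y : y != 0 -> label (- y) = flip_sign (label y).
Proof.
move=> y0; rewrite /label normrN.
rewrite (@eq_pick _ _ (fun j => `|y ord0 j| == `|y|)); last first.
  by move=> j /=; rewrite mxE normrN.
case: pickP => [j /eqP jy|h]; last first.
  by have [i hi] := norm_attained y0; have := h i; rewrite hi eqxx.
rewrite mxE oppr_gt0 /flip_sign /=; congr (_, _).
rewrite -leNgt le_eqVlt orb_idl // => /eqP yj0; move: y0.
by rewrite -normr_eq0 -jy yj0 normr0 eqxx.
Qed.

(** Two vectors with the same dominant coordinate and opposite signs there are
    at a distance at least the sum of their norms. *)
Lemma label_close (d : R) y z : d <= `|y| -> d <= `|z| -> 0 < d -> `|y - z| < d ->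
  (label y).1 = (label z).1 -> label y = label z.
Proof.
move=> dy dz d0 yz.
have y0 : y != 0 by rewrite -normr_gt0; exact: lt_le_trans dy.
have z0 : z != 0 by rewrite -normr_gt0; exact: lt_le_trans dz.
have [j jy ->] := labelP y0; have [l lz ->] := labelP z0 => /= /val_inj jl.
rewrite -{l}jl in lz *; congr (_, _).
have := le_lt_trans (coord_norm (y - z) j) yz; rewrite !mxE.
rewrite -jy in dy; rewrite -lz in dz.
have [yp|yn] := ltP 0 (y ord0 j); have [zp|zn] := ltP 0 (z ord0 j) => //.
  rewrite gtr0_norm // in dy; rewrite ler0_norm // in dz => h.
  by have := le_lt_trans (ler_norm _) h; lra.
rewrite ler0_norm // in dy; rewrite gtr0_norm // in dz; rewrite distrC => h.
by have := le_lt_trans (ler_norm _) h; lra.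
Qed.

End Labels.

(** * The Borsuk-Ulam theorem *)

Section BorsukUlam.
Context {R : realType} {c : nat}.
Implicit Types (p v : 'rV[R]_c).

(** The boundary of the cross-polytope: it is a union of simplices, one for each
    choice of signs, exchanged by the antipode. *)
Definition l1_sphere : set 'rV[R]_c := [set p | \sum_i `|p ord0 i| = 1].

Definition basis_vector (j : nat) : 'rV[R]_c := \row_i (i == j :> nat)%:R.

(** The cone from the d-th basis vector over the (d - 1)-sphere, which is the
    union of a (d - 1)-hemisphere and its antipode; thus half of the
    d-dimensional cross-polytope. *)
Fixpoint hemisphere (d : nat) : seq (seq 'rV[R]_c) :=
  if d is d'.+1 then
    map (cons (basis_vector d))
        (hemisphere d' ++ map (map -%R) (hemisphere d'))
  else [:: [:: basis_vector 0]].

(** The base of the cone is a cycle: its boundary is made of the two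
    hemispheres one dimension lower, each of them counted twice. *)
Lemma boundary_hemisphere d :
  eq_mod2 (boundary (hemisphere d.+1))
             (hemisphere d ++ map (map -%R) (hemisphere d)).
Proof.
elim: d => [|d IH] phi.
  rewrite /= /boundary /= !parity_cons !parity_nil.
  case: (phi [:: _]); case: (phi [:: basis_vector 1]);
    by case: (phi [:: - _]).
rewrite [hemisphere d.+2]/= -[map (cons _) _ ++ _]/(hemisphere d.+1 ++ _).
set H := hemisphere d.+1 ++ _.
rewrite boundary_cone parity_cat.
suff H0 : eq_mod2 (boundary H) [::].
  have := H0 (fun t => phi (basis_vector d.+2 :: t)).
  by rewrite /parity [in X in _ -> X]big_map => ->; rewrite big_nil addbF.
move=> psi; rewrite boundary_cat parity_cat boundary_map parity_map !IH.
rewrite !parity_cat !parity_map parity_nil.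
have -> : parity ((psi \o map -%R) \o map -%R) (hemisphere d) = parity psi (hemisphere d).
  apply: eq_in_parity => t _ /=; rewrite -map_comp map_id_in // => v _ /=.
  by rewrite opprK.
by rewrite addbC [X in X (+) _]addbC addbA; case: (parity _ _); case: (parity _ _).
Qed.

Lemma hemisphere_size d s : s \in hemisphere d -> size s = d.+1.
Proof.
elim: d s => [|d IH] s; first by rewrite inE => /eqP->.
move=> /mapP[t]; rewrite mem_cat => /orP[/IH th ->|/mapP[u /IH uh ->] ->] /=.
  by rewrite th.
by rewrite size_map uh.
Qed.

Lemma hemisphere_vertices d s : s \in hemisphere d ->
  exists eps : nat -> bool, forall v, v \in s ->
    exists2 j, (j <= d)%N & v = (-1) ^+ eps j *: basis_vector j.
Proof.
elim: d s => [|d IH] s.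
  rewrite inE => /eqP->; exists (fun=> false) => v; rewrite inE => /eqP->.
  by exists 0%N; rewrite // expr0 scale1r.
move=> /mapP[t + ->]; rewrite mem_cat => tH.
have [eps epsP] : exists eps : nat -> bool, forall v, v \in t ->
    exists2 j, (j <= d)%N & v = (-1) ^+ eps j *: basis_vector j.
  case/orP: tH => [/IH//|/mapP[u /IH[eps epsP] ->]].
  exists (fun j => ~~ eps j) => v /mapP[w /epsP[j jd ->] ->]; exists j => //.
  by rewrite signrN scaleNr.
exists (fun j => (j <= d)%N && eps j) => v; rewrite inE => /predU1P[->|/epsP[j jd ->]].
  by exists d.+1; rewrite // ltnn /= expr0 scale1r.
by exists j; [exact: leqW | rewrite jd].
Qed.

(** The face of the cross-polytope with signs eps, as a convex set. *)
Definition orthant_face (eps : nat -> bool) (p : 'rV[R]_c) : Prop :=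
  (forall i : 'I_c, 0 <= (-1) ^+ eps i * p ord0 i) /\
  \sum_(i < c) (-1) ^+ eps i * p ord0 i = 1.

Lemma orthant_face_l1 eps p : orthant_face eps p -> l1_sphere p.
Proof.
move=> [p0 p1]; rewrite /l1_sphere /= -p1; apply: eq_bigr => i _.
by rewrite -[RHS]ger0_norm // normrM normr_sign mul1r.
Qed.

Lemma orthant_face_vertex eps j : (j < c)%N ->
  orthant_face eps ((-1) ^+ eps j *: basis_vector j).
Proof.
move=> jc.
have E (i : 'I_c) : (-1) ^+ eps i * ((-1) ^+ eps j *: basis_vector j) ord0 i
    = (i == j :> nat)%:R :> R.
  rewrite !mxE; case: eqP => [->|_]; last by rewrite !mulr0.
  by rewrite mulr1 -expr2 sqrr_sign.
split=> [i|]; first by rewrite E.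
rewrite (eq_bigr _ (fun i _ => E i)) (bigD1 (Ordinal jc)) //= eqxx.
by rewrite big1 ?addr0 // => i ij; rewrite -val_eqE /= in ij; rewrite (negbTE ij).
Qed.

Lemma bary_coord (s : seq 'rV[R]_c) i :
  bary s ord0 i = (size s)%:R^-1 * \sum_(v <- s) v ord0 i.
Proof. by rewrite /bary mxE summxE. Qed.

Lemma orthant_face_mean_closed eps : mean_closed (orthant_face eps).
Proof.
move=> s s0 h; have sz : (size s)%:R != 0 :> R by rewrite pnatr_eq0 size_eq0.
split=> [i|].
  rewrite bary_coord mulrCA mulr_ge0 ?invr_ge0 //.
  by rewrite mulr_sumr big_seq sumr_ge0 // => v /h[].
under eq_bigr do rewrite bary_coord mulrCA mulr_sumr.
rewrite -mulr_sumr exchange_big /= big_seq (eq_bigr (fun=> 1)); last first.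
  by move=> v /h[].
by rewrite -big_seq big_const_seq count_predT iter_addr addr0 mulVf.
Qed.

Lemma compact_l1_sphere : compact l1_sphere.
Proof.
apply: bounded_closed_compact.
  exists 1; split => // M M1 p pP; apply: le_trans (ltW M1).
  apply: norm_coord_le => // i.
  by rewrite -pP (bigD1 i) //= lerDl sumr_ge0.
have -> : l1_sphere = (fun p : 'rV[R]_c => \sum_i `|p ord0 i|) @^-1` [set 1] by [].
apply: closed_comp; last exact: closed_eq.
move=> p _; apply: (@continuous_sum R 'rV[R]_c) => i x.
apply: (@continuous_comp _ _ _ (fun p : 'rV[R]_c => p ord0 i) Num.norm).
  exact: coord_continuous.
exact: norm_continuous.
Qed.

(** Suppose that g does not vanish.  Subdivide the hemispheres so finely that,
    by uniform continuity, labelling p by the label of g p makes all simplices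
    consistent.  Let a_d be the parity of the number of alternating
    d-simplices (for both initial signs) of the d-hemisphere.  By Ky Fan's
    lemma a_d counts the positive alternating facets of its boundary, which
    consists of a (d - 1)-hemisphere and its antipode; the antipode exchanges
    the initial signs, so this number is a_(d-1).  Hence a_m = a_0 = 1, whereas
    m + 1 distinct coordinates are not available in dimension m. *)
Theorem borsuk_ulam m (g : 'rV[R]_c -> 'rV[R]_m) : (m < c)%N ->
  {within l1_sphere, continuous g} ->
  (forall p, l1_sphere p -> g (- p) = - g p) ->
  exists2 p, l1_sphere p & g p = 0.
Proof.
move=> mc cg og; apply: contrapT => gN0.
have g0 p : l1_sphere p -> g p != 0.
  by move=> pP; apply/eqP => gp; apply: gN0; exists p.
have P0 : l1_sphere (basis_vector 0).
  apply: (@orthant_face_l1 (fun=> false)).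
  have := @orthant_face_vertex (fun=> false) 0 (leq_ltn_trans (leq0n _) mc).
  by rewrite expr0 scale1r.
(* Lower bound for g on the compact sphere: the threshold of [label_close]. *)
have [delta d0 dP] : exists2 d : R, 0 < d & forall p, l1_sphere p -> d <= `|g p|.
  have cng : {within l1_sphere, continuous (fun p => `|g p| : R)}.
    by move=> p; apply: cvg_norm; exact: cg.
  have [q qP qmin] := EVT_min_rV (ex_intro _ _ P0) compact_l1_sphere cng.
  exists `|g q|; first by rewrite normr_gt0; apply: g0; rewrite inE in qP.
  by move=> p pP; apply: qmin; rewrite inE.
have [eta e0 eP] := compact_unif_continuous compact_l1_sphere cg d0.
set q : R := m%:R / m.+1%:R.
have q0 : 0 <= q by rewrite divr_ge0.
(* Edges of the cross-polytope have sup norm length at most 2. *)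
have [N qN] : exists N, q ^+ N * 2 < eta.
  have q1 : `|q| < 1 by rewrite ger0_norm // ltr_pdivrMr // mul1r ltr_nat.
  have e20 : 0 < eta / 2 by rewrite divr_gt0.
  have /cvgrPdist_lt /(_ _ e20) [N _ /(_ N (leqnn N))] := cvg_expr q1.
  rewrite sub0r normrN ger0_norm ?exprn_ge0 // => h; exists N.
  by rewrite -ltr_pdivlMr.
pose Sd d := iter N (sd_chain bary) (hemisphere d).
have SdP d t : (d < c)%N -> t \in Sd d -> forall v, v \in t -> l1_sphere v.
  move=> dc tS.
  have hH s : s \in hemisphere d -> exists eps, forall v, v \in s -> orthant_face eps v.
    move=> /hemisphere_vertices[eps epsP]; exists eps => v /epsP[j jd ->].
    by apply: orthant_face_vertex; exact: leq_ltn_trans dc.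
  have [eps epsP] := iter_sd_mean_closed orthant_face_mean_closed hH tS.
  by move=> v vt; exact: orthant_face_l1 (epsP v vt).
pose lab v := label (g v).
have labm v : l1_sphere v -> ((lab v).1 < m)%N.
  by move=> vP; rewrite /lab; have [j _ ->] := labelP (g0 v vP) => /=.
have Sdc d t : (d <= m)%N -> t \in Sd d -> consistent (map lab t).
  move=> dm tS.
  have dc := leq_ltn_trans dm mc.
  have mesht : mesh_le (q ^+ N * 2) t.
    apply: (@iter_sd_mesh_le _ _ d.+1) tS => //; first exact: hemisphere_size.
    move=> s sH u v us vs; have [eps epsP] := hemisphere_vertices sH.
    have nP w : w \in s -> `|w| <= 1.
      move=> /epsP[j jd ->]; rewrite normrZ normr_sign mul1r.
      apply: norm_coord_le => // i; rewrite mxE.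
      by case: (_ == _); rewrite ?normr1 ?normr0.
    by apply: le_trans (ler_normB _ _) _; have := nP u us; have := nP v vs; lra.
  move=> x y /mapP[u ut ->] /mapP[v vt ->] /=.
  have uP := SdP _ _ dc tS _ ut; have vP := SdP _ _ dc tS _ vt.
  apply: label_close (dP u uP) (dP v vP) d0 _; apply: eP => //.
  exact: le_lt_trans (mesht _ _ ut vt) qN.
have lab_opp d t : (d < c)%N -> t \in Sd d ->
    map lab (map -%R t) = map flip_sign (map lab t).
  move=> dc tS; rewrite -!map_comp; apply/eq_in_map => v vt /=.
  have vP := SdP _ _ dc tS _ vt.
  by rewrite /lab og // label_opp // g0.
pose A b (t : seq 'rV[R]_c) := ky_fan b (map lab t).
have boundary_count d : (d <= m)%N -> parity (A true) (boundary (Sd d)) =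
    parity (A true) (Sd d) (+) parity (A false) (Sd d).
  move=> dm; rewrite /boundary parity_flatten_map -parity_addb.
  apply: eq_in_parity => t tS; rewrite /A -(ky_fan_facets true) //; last exact: Sdc tS.
  by rewrite faces_map parity_map.
have oddness d : (d <= m)%N -> parity (A true) (boundary (Sd d)) = true.
  elim: d => [|d IH] dm.
    rewrite boundary_iter_sd /boundary /=.
    have -> : iter N (sd_chain bary) [:: [::]] = [:: [::]] :> seq (seq 'rV[R]_c).
      by elim: (N) => //= ? ->.
    by rewrite parity_cons parity_nil.
  rewrite boundary_iter_sd (iter_sd_eq_mod2 _ _ (boundary_hemisphere d)).
  rewrite iter_sd_cat parity_cat iter_sd_map; last exact: bary_opp.
  rewrite parity_map -[RHS](IH (ltnW dm)) boundary_count ?(ltnW dm) //; congr (_ (+) _).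
  apply: eq_in_parity => t tS.
  rewrite -[RHS]/(ky_fan (~~ true) (map lab t)) -ky_fan_flip -(lab_opp d) //.
  exact: ltn_trans dm mc.
have := oddness m (leqnn m); rewrite boundary_count //.
suff H b : parity (A b) (Sd m) = false by rewrite !H.
apply: parity_all_false => t tS; rewrite /A (@ky_fan_size _ m) //.
  by move=> x /mapP[v vt ->]; apply: labm; exact: SdP mc tS v vt.
by rewrite size_map (iter_sd_size (@hemisphere_size m) tS).
Qed.

End BorsukUlam.

(** * The genus in terms of zeros of odd maps *)

Lemma continuous_row {R : realType} {V : normedModType R} {n} (f : V -> 'rV[R]_n) :
  (forall i, continuous (fun x => f x ord0 i)) -> continuous f.
Proof.
move=> cf; apply/continuous_subspace_setT; apply: within_continuous_row => i.
exact/continuous_subspaceT/cf.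
Qed.

Lemma continuous_mulmx {R : realType} {m n : nat} (M : 'M[R]_(m, n)) :
  continuous (fun x : 'rV[R]_m => x *m M).
Proof.
apply: continuous_row => i; under eq_fun do rewrite mxE.
apply: (@continuous_sum R 'rV[R]_m) => j x.
apply: (@cvgM R _ (nbhs x)); [exact: coord_continuous | exact: cvg_cst].
Qed.

Section Dot.
Context {R : realType} {n : nat}.
Implicit Types x y : 'rV[R]_n.

Lemma dotv_ge0 x : 0 <= dotv x x.
Proof. by apply: sumr_ge0 => i _; rewrite -expr2 sqr_ge0. Qed.

Lemma dotv_eq0 x : (dotv x x == 0) = (x == 0).
Proof.
apply/idP/eqP => [|->]; last by rewrite /dotv big1 // => i _; rewrite mxE mul0r.
rewrite psumr_eq0 => [/allP h|i _]; last by rewrite -expr2 sqr_ge0.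
apply/rowP => i; have := h i (mem_index_enum i); rewrite /= mulf_eq0 orbb mxE.
by move/eqP.
Qed.

Lemma dotv_opp x : dotv (- x) (- x) = dotv x x.
Proof. by apply: eq_bigr => i _; rewrite !mxE mulrNN. Qed.

Lemma dotvZ (a : R) x : dotv (a *: x) (a *: x) = a ^+ 2 * dotv x x.
Proof. by rewrite mulr_sumr; apply: eq_bigr => i _; rewrite !mxE; ring. Qed.

Lemma continuous_dotv : continuous (fun x => dotv x x).
Proof.
apply: (@continuous_sum R 'rV[R]_n) => i x.
by apply: (@cvgM R _ (nbhs x)); exact: coord_continuous.
Qed.

Definition normalize x := (Num.sqrt (dotv x x))^-1 *: x.

Lemma normalize_opp x : normalize (- x) = - normalize x.
Proof. by rewrite /normalize dotv_opp scalerN. Qed.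

Lemma dotv_normalize x : x != 0 -> dotv (normalize x) (normalize x) = 1.
Proof.
rewrite -dotv_eq0 => x0; rewrite dotvZ exprVn sqr_sqrtr ?dotv_ge0 //.
by rewrite mulVf.
Qed.

Lemma continuous_normalize x : x != 0 -> {for x, continuous normalize}.
Proof.
move=> x0; apply: (@cvgZ R _ _ (nbhs x)); last exact: cvg_id.
apply: cvgV; first by rewrite sqrtr_eq0 -ltNge lt_neqAle eq_sym dotv_eq0 x0 dotv_ge0.
apply: (@continuous_comp _ _ _ (fun x => dotv x x) Num.sqrt).
  exact: continuous_dotv.
exact: sqrt_continuous.
Qed.

End Dot.

Section Genus.
Context {R : realType} {n : nat}.
Implicit Types (S : set 'rV[R]_n).

(** Together with nonemptiness this is the inequality i <= genus S (see
    [genus_geP]), in a form that involves neither the extended reals nor unit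
    spheres. *)
Definition odd_maps_vanish S (i : nat) := forall s (g : 'rV[R]_n -> 'rV[R]_s),
  (s < i)%N -> {within S, continuous g} -> (forall x, S x -> g (- x) = - g x) ->
  exists2 x, S x & g x = 0.

(** A nonvanishing odd map can be normalized to take values in the sphere. *)
Lemma genus_geP S i : S !=set0 ->
  ((i%:R)%:E <= genus S)%E <-> odd_maps_vanish S i.
Proof.
move=> [x0 Sx0]; split=> [ige s g si cg og|h].
  apply: contrapT => gN.
  have g0 x : S x -> g x != 0.
    by move=> Sx; apply/eqP => gx; apply: gN; exists x.
  have s0 : (0 < s)%N.
    rewrite lt0n; apply/eqP => s0; have := g0 _ Sx0.
    by move: (g x0); rewrite s0 => y; rewrite thinmx0 eqxx.
  suff : (genus S <= (s%:R)%:E)%E.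
    by move/(le_trans ige); rewrite lee_fin ler_nat leqNgt si.
  apply: ereal_inf_lbound; exists s => //; split=> //.
  exists (normalize \o g); split.
  - apply: within_continuous_comp cg => y; rewrite inE => -[x Sx <-].
    by apply: continuous_normalize; exact: g0.
  - by move=> x Sx; rewrite /= og // normalize_opp.
  - by move=> x Sx; rewrite dotv_normalize // g0.
apply: le_ereal_inf_tmp => _ [s [s0 [g [cg og g1]]] <-].
rewrite lee_fin ler_nat leqNgt; apply/negP => si.
have [x Sx gx] := h s g si cg og.
have := g1 x Sx; rewrite gx => /eqP.
have /eqP -> : dotv (0 : 'rV[R]_s) 0 == 0 by rewrite dotv_eq0.
by rewrite eq_sym oner_eq0.
Qed.

Lemma genus_gt0 S (r : nat) : genus S = (r%:R)%:E -> (0 < r)%N.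
Proof.
move=> Sr; suff : (1%:E <= genus S)%E by rewrite Sr lee_fin -[1]/(1%:R) ler_nat.
by apply: le_ereal_inf_tmp => _ [s [s0 _] <-]; rewrite lee_fin ler1n.
Qed.

(** An infimum of positive integers is attained. *)
Lemma genus_attained S (r : nat) : genus S = (r%:R)%:E -> odd_map_to_sphere S r.
Proof.
move=> Sr.
have r0 := genus_gt0 Sr.
apply: contrapT => Nr.
have : ((r.+1%:R)%:E <= genus S)%E.
  apply: le_ereal_inf_tmp => _ [s [s0 hs] <-]; rewrite lee_fin ler_nat.
  rewrite ltnNge; apply/negP => sr.
  have : (r%:R%:E <= s%:R%:E :> \bar R)%E.
    by rewrite -Sr; apply: ereal_inf_lbound; exists s.
  rewrite lee_fin ler_nat => rs; have srE : s = r by apply/eqP; rewrite eqn_leq sr.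
  by apply: Nr; rewrite -srE.
by rewrite Sr lee_fin ler_nat ltnn.
Qed.

End Genus.

(** An odd map on the image pulls back to an odd map on S. *)
Lemma odd_maps_vanish_image {R : realType} {m n} (S : set 'rV[R]_m)
    (h : 'rV[R]_m -> 'rV[R]_n) i :
  {within S, continuous h} -> (forall x, S x -> h (- x) = - h x) ->
  odd_maps_vanish S i -> odd_maps_vanish (h @` S) i.
Proof.
move=> ch oh hS s g si cg og.
have [|x Sx|x Sx gx] := hS s (g \o h) si.
- apply/within_continuousP => x Sx e e0.
  have hSx : (h @` S) (h x) by exists x.
  have [d d0 dP] := (within_continuousP _ _).1 cg _ hSx e e0.
  have [d' d'0 d'P] := (within_continuousP _ _).1 ch _ Sx d d0.
  by exists d' => // y Sy xy; apply: dP; [exists y | exact: d'P].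
- by rewrite /= oh // og //; exists x.
- by exists (h x) => //; exists x.
Qed.


Section LinearSphere.
Context {R : realType} {c n : nat} (M : 'M[R]_(c, n)).

(** When M is row free, this is the boundary of a cross-polytope in the row
    space of M; it replaces the unit sphere of that subspace. *)
Definition linear_sphere : set 'rV[R]_n := [set p *m M | p in @l1_sphere R c].

Lemma l1_sphere_opp (p : 'rV[R]_c) : l1_sphere p -> l1_sphere (- p).
Proof. by rewrite /l1_sphere /= => <-; apply: eq_bigr => i _; rewrite mxE normrN. Qed.

Lemma linear_sphere_opp x : linear_sphere x -> linear_sphere (- x).
Proof. by move=> [p pP <-]; exists (- p); [exact: l1_sphere_opp | rewrite mulNmx]. Qed.

Lemma compact_linear_sphere : compact linear_sphere.
Proof.
apply: continuous_compact; last exact: compact_l1_sphere.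
exact/continuous_subspaceT/continuous_mulmx.
Qed.

Lemma linear_sphere_neq0 : row_free M -> ~ linear_sphere 0.
Proof.
move=> fM [p pP pM]; have p0 : p = 0.
  by apply: (row_free_inj fM); rewrite pM mul0mx.
move: pP; rewrite p0 /l1_sphere /= big1 => [/eqP|i _];
  by rewrite ?mxE ?normr0 // eq_sym oner_eq0.
Qed.

Lemma linear_sphere_sub x : linear_sphere x -> (x <= M)%MS.
Proof. by move=> [p _ <-]; exact: submxMl. Qed.

Lemma linear_sphere_odd_maps_vanish : odd_maps_vanish linear_sphere c.
Proof.
apply: odd_maps_vanish_image => [|p _|s g]; last exact: borsuk_ulam.
  exact/continuous_subspaceT/continuous_mulmx.
exact: mulNmx.
Qed.

Lemma linear_sphere_nonempty : (0 < c)%N -> linear_sphere !=set0.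
Proof.
move=> c0; have := @orthant_face_vertex R c (fun=> false) 0 c0.
by move/orthant_face_l1 => h; eexists; eexists; first exact: h.
Qed.

End LinearSphere.

(** * Odd extension from closed sets *)

Section OddExtension.
Context {R : realType} {n r : nat}.

(** Tietze's theorem in each coordinate, followed by antisymmetrization. *)
Lemma odd_continuous_extension (C : set 'rV[R]_n) (f : 'rV[R]_n -> 'rV[R]_r) (b : R) :
  closed C -> symmetric_set C -> {within C, continuous f} ->
  (forall x, C x -> f (- x) = - f x) -> (forall x, C x -> `|f x| <= b) ->
  exists g : 'rV[R]_n -> 'rV[R]_r,
    [/\ continuous g, forall x, g (- x) = - g x & forall x, C x -> g x = f x].
Proof.
move=> clC sC cf of' fb.
have H i : {h : 'rV[R]_n -> R | continuous h /\ forall x, C x -> h x = f x ord0 i}.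
  apply: cid.
  have b0 : 0 < Num.max b 1 by rewrite lt_max ltr01 orbT.
  have cfi : {within C, continuous (fun x => f x ord0 i : R^o)}.
    move=> x; apply: (@continuous_comp (subspace C) _ _ f (fun y => y ord0 i)).
      exact: cf.
    exact: coord_continuous.
  have [|h [hf ch _]] := continuous_bounded_extension
     (@pseudometric_normal R 'rV[R]_n) clC b0 cfi.
    move=> x Cx; apply: le_trans (coord_norm (f x) i) _.
    by rewrite le_max fb.
  by exists h; split => // x Cx; rewrite hf // inE.
exists (fun x => \row_i ((sval (H i) x - sval (H i) (- x)) / 2)); split.
- apply: continuous_row => i; under eq_fun do rewrite mxE.
  case: (H i) => h [ch _] /= x.
  apply: (@cvgM R _ (nbhs x)); last exact: cvg_cst.
  apply: (@cvgB R R _ (nbhs x)); first exact: ch.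
  have ch' : continuous (h \o -%R).
    by move=> y; apply: continuous_comp; [exact: opp_continuous | exact: ch].
  exact: ch'.
- by move=> x; apply/rowP => i; rewrite !mxE opprK; ring.
- move=> x Cx; apply/rowP => i; rewrite mxE; case: (H i) => h [_ hP] /=.
  by rewrite !hP // ?of' // ?mxE; [field | exact: sC].
Qed.

End OddExtension.

(** * Forms of symmetric tensors and the gradient step *)

Section ProductExpansion.
Context {R : realDomainType} {T : Type}.
Implicit Types (a b : T -> R) (s : seq T).

(** The derivative at a of the product over s, in the direction b. *)
Fixpoint dprod a b s : R :=
  if s is j :: s' then b j * \prod_(i <- s') a i + a j * dprod a b s' else 0.

Definition head_dprod a b s : R :=
  if s is j :: s' then b j * \prod_(i <- s') a i else 0.

(** Rotating the list brings each factor in turn to the front; on tensors the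
    rotations are then absorbed by symmetry. *)
Lemma dprod_rot a b s : dprod a b s = \sum_(p < size s) head_dprod a b (rot p s).
Proof.
elim: s => [|j s IH]; first by rewrite big_ord0.
rewrite big_ord_recl rot0 /= IH mulr_sumr; congr (_ + _).
apply: eq_bigr => p _; rewrite /bump /= add1n /rot /=.
case E : (drop p s) => [|i d].
  by have := size_drop p s; rewrite E /= => /esym/eqP; rewrite subn_eq0 leqNgt ltn_ord.
by rewrite /= !big_cat /= big_cons; ring.
Qed.

(** Taylor expansion to first order with an explicit remainder; the constant 3
    bounds the three terms produced by one more factor, and the first two
    bounds only serve the induction. *)
Lemma prod_expansion (B d : R) a b s : 0 <= d <= 1 ->
  (forall j, `|a j| <= B) -> (forall j, `|b j| <= B) ->
  [/\ `|\prod_(j <- s) a j| <= (3 * B) ^+ size s,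
      `|dprod a b s| <= (3 * B) ^+ size s &
      `|\prod_(j <- s) (a j + d * b j) - \prod_(j <- s) a j - d * dprod a b s|
        <= d ^+ 2 * (3 * B) ^+ size s].
Proof.
move=> /andP[d0 d1] aB bB; elim: s => [|j s [IP IL IE]].
  rewrite !big_nil /= mulr0 subrr subr0 normr0 normr1 expr0 mulr1.
  by rewrite ler01 lexx sqr_ge0.
rewrite !big_cons /=; move: IP IL IE.
set P := \prod_(j <- s) a j; set P' := \prod_(j <- s) (_ + _); set L := dprod a b s.
set K := (3 * B) ^+ size s => IP IL IE.
have B0 : 0 <= B := le_trans (normr_ge0 _) (aB j).
have K0 : 0 <= K by rewrite exprn_ge0 // mulr_ge0.
rewrite exprS -/K.
have aP : `|a j * P| <= B * K by rewrite normrM ler_pM.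
have bP : `|b j * P| <= B * K by rewrite normrM ler_pM.
have aL : `|a j * L| <= B * K by rewrite normrM ler_pM.
have bL : `|b j * L| <= B * K by rewrite normrM ler_pM.
have BK : 0 <= B * K by rewrite mulr_ge0.
split.
- by apply: le_trans aP _; lra.
- by apply: le_trans (ler_normD _ _) _; lra.
set E := P' - P - d * L in IE.
have -> : (a j + d * b j) * P' - a j * P - d * (b j * P + a j * L) =
    d ^+ 2 * (b j * L) + a j * E + d * (b j * E) by rewrite /E; ring.
have aE : `|a j * E| <= B * (d ^+ 2 * K) by rewrite normrM ler_pM.
have bE : `|b j * E| <= B * (d ^+ 2 * K) by rewrite normrM ler_pM.
have dbE : `|d * (b j * E)| <= B * (d ^+ 2 * K).
  rewrite normrM (ger0_norm d0); apply: le_trans bE.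
  by rewrite ler_piMl.
have dbL : `|d ^+ 2 * (b j * L)| <= d ^+ 2 * (B * K).
  by rewrite normrM ger0_norm ?sqr_ge0 // ler_wpM2l ?sqr_ge0.
have -> : d ^+ 2 * (3 * B * K) = d ^+ 2 * (B * K) + B * (d ^+ 2 * K) + B * (d ^+ 2 * K).
  by ring.
apply: le_trans (ler_normD _ _) _; apply: lerD => //.
by apply: le_trans (ler_normD _ _) _; apply: lerD.
Qed.

End ProductExpansion.

Lemma dotvN {R : realType} {n : nat} (x y : 'rV[R]_n) : dotv x (- y) = - dotv x y.
Proof. by rewrite /dotv -sumrN; apply: eq_bigr => i _; rewrite mxE mulrN. Qed.

Section Forms.
Context {R : realType} {k n : nat}.
Implicit Types (C : tensor R k n) (x v : 'rV[R]_n).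

Definition form C x : R := dotv (tensor_app C x) x.

(** Every index tuple has a head since k is positive. *)
Lemma sum_by_head (F : k.-tuple 'I_n -> R) : (0 < k)%N ->
  \sum_i \sum_(t : k.-tuple 'I_n | ohead t == Some i) F t = \sum_t F t.
Proof.
move=> k0; rewrite (exchange_big_dep xpredT) //=; apply: eq_bigr => -[[|i s] ss] _ /=.
  by rewrite -(eqP ss) in k0.
by rewrite (big_pred1 i) // => j; rewrite /= eq_sym; exact/eqP/eqP => [->|[->]].
Qed.

Lemma dotv_tensor_app C x v : (0 < k)%N ->
  dotv (tensor_app C x) v =
  \sum_t C t * head_dprod (fun j => x ord0 j) (fun j => v ord0 j) t.
Proof.
move=> k0; rewrite -[RHS]sum_by_head //; apply: eq_bigr => i _.
rewrite mxE mulr_suml; apply: eq_bigr => -[[|j s] ss] //= /eqP[->].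
by ring.
Qed.

Lemma formE C x : (0 < k)%N -> form C x = \sum_t C t * \prod_(j <- t) x ord0 j.
Proof.
move=> k0; rewrite /form dotv_tensor_app //; apply: eq_bigr => -[[|j s] ss] _ /=.
  by rewrite -(eqP ss) in k0.
by rewrite big_cons.
Qed.

(** The left-hand side is the derivative of the form at x in the direction v.
    Each rotation of the index tuples gives the same contribution since C is
    symmetric, whence the factor k. *)
Lemma sum_dprod C x v : (0 < k)%N -> symmetric_tensor C ->
  \sum_t C t * dprod (fun j => x ord0 j) (fun j => v ord0 j) t =
  k%:R * dotv (tensor_app C x) v.
Proof.
move=> k0 sC; set h := head_dprod (fun j => x ord0 j) (fun j => v ord0 j).
transitivity (\sum_(p < k) \sum_t C t * h (rot p t)).
  rewrite exchange_big; apply: eq_bigr => t _ /=.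
  by rewrite dprod_rot size_tuple mulr_sumr.
rewrite (eq_bigr (fun=> dotv (tensor_app C x) v)) => [|p _].
  by rewrite sumr_const card_ord mulr_natl.
rewrite dotv_tensor_app //.
rewrite [RHS](reindex (fun t : k.-tuple 'I_n => [tuple of rot p t])) /=.
  apply: eq_bigr => t _; congr (_ * _); apply: sC.
  by rewrite /= perm_sym perm_rot.
exists (fun t : k.-tuple 'I_n => [tuple of rotr p t]) => t _;
  by apply: val_inj; rewrite /= ?rotK ?rotrK.
Qed.

Lemma form_expansion C x v (B d : R) : (0 < k)%N -> symmetric_tensor C ->
  0 <= d <= 1 -> `|x| <= B -> `|v| <= B ->
  `|form C (x + d *: v) - form C x - d * (k%:R * dotv (tensor_app C x) v)|
  <= d ^+ 2 * ((\sum_t `|C t|) * (3 * B) ^+ k).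
Proof.
move=> k0 sC d01 xB vB; rewrite -sum_dprod // !formE // mulr_sumr -!sumrB.
rewrite mulr_suml mulr_sumr; apply: le_trans (ler_norm_sum _ _ _) _.
apply: ler_sum => t _.
have [_ _] := @prod_expansion R _ B d (fun j => x ord0 j) (fun j => v ord0 j) t d01
  (fun j => le_trans (coord_norm x j) xB) (fun j => le_trans (coord_norm v j) vB).
rewrite size_tuple => h.
rewrite (eq_bigr (fun j => x ord0 j + d * v ord0 j)) => [|j _]; last by rewrite !mxE.
rewrite [d * (C t * _)]mulrCA -!mulrBr normrM mulrCA ler_wpM2l //.
Qed.

Lemma continuous_tensor_app C : continuous (tensor_app C).
Proof.
apply: continuous_row => i; under eq_fun do rewrite mxE.
apply: (@continuous_sum R 'rV[R]_n) => t x.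
apply: (@cvgM R _ (nbhs x)); first exact: cvg_cst.
apply: (@continuous_prod R 'rV[R]_n) => j y; exact: coord_continuous.
Qed.

Lemma continuous_form C : continuous (form C).
Proof.
apply: (@continuous_sum R 'rV[R]_n) => i x.
apply: (@cvgM R _ (nbhs x)); last exact: coord_continuous.
apply: (@continuous_comp _ _ _ (tensor_app C) (fun y => y ord0 i)).
  exact: continuous_tensor_app.
exact: coord_continuous.
Qed.

Lemma prod_scale (a : R) x (s : seq 'I_n) :
  \prod_(j <- s) (a *: x) ord0 j = a ^+ size s * \prod_(j <- s) x ord0 j.
Proof.
elim: s => [|j s IH]; first by rewrite !big_nil mulr1.
by rewrite !big_cons IH mxE exprS; ring.
Qed.

Lemma tensor_appZ C (a : R) x : tensor_app C (a *: x) = a ^+ k.-1 *: tensor_app C x.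
Proof.
apply/rowP => i; rewrite !mxE mulr_sumr; apply: eq_bigr => t _.
by rewrite prod_scale size_behead size_tuple mulrCA.
Qed.

Lemma formZ C (a : R) x : (0 < k)%N -> form C (a *: x) = a ^+ k * form C x.
Proof.
move=> k0; rewrite !formE // mulr_sumr; apply: eq_bigr => t _.
by rewrite prod_scale size_tuple mulrCA.
Qed.

Lemma tensor_app_opp C x : (0 < k)%N -> ~~ odd k -> tensor_app C (- x) = - tensor_app C x.
Proof.
move=> k0 ek; rewrite -scaleN1r tensor_appZ -signr_odd.
have -> : odd k.-1 by move: ek; rewrite -{1}(prednK k0) /= negbK.
by rewrite expr1 scaleN1r.
Qed.

Lemma compact_norm_bound (Z : set 'rV[R]_n) (m : nat) (f : 'rV[R]_n -> 'rV[R]_m) :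
  compact Z -> continuous f -> exists B, forall x, Z x -> `|f x| <= B.
Proof.
move=> cZ cf.
have [Z0|/set0P/negP/negPn/eqP->] := pselect (Z !=set0); last by exists 0.
have cn : {within Z, continuous (fun x => `|f x| : R)}.
  apply: continuous_subspaceT => x.
  by apply: continuous_comp; [exact: cf | exact: norm_continuous].
have [c _ cmax] := EVT_max_rV Z0 cZ cn.
by exists `|f c| => x Zx; apply: cmax; rewrite inE.
Qed.

(** The first order term of the step is -d * k times the squared norm of
    C x^(k-1), which by compactness is bounded below on Z; for small d it
    dominates the quadratic remainder of [form_expansion]. *)
Lemma gradient_step_decrease C (Z : set 'rV[R]_n) : (0 < k)%N -> symmetric_tensor C ->
  compact Z -> (forall x, Z x -> tensor_app C x != 0) ->
  exists d mu : R, [/\ 0 < d, 0 < mu &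
    forall x, Z x -> form C (x - d *: tensor_app C x) <= form C x - mu].
Proof.
move=> k0 sC cZ Z0.
have [Zn0|/set0P/negP/negPn/eqP->] := pselect (Z !=set0); last by exists 1, 1.
have idc : continuous (fun x : 'rV[R]_n => x) by move=> x; exact: cvg_id.
have [B1 B1P] := compact_norm_bound cZ idc.
have [B2 B2P] := compact_norm_bound cZ (@continuous_tensor_app C).
set B := Num.max B1 B2.
have cg : {within Z, continuous (fun x => dotv (tensor_app C x) (tensor_app C x))}.
  apply: continuous_subspaceT => x.
  apply: (@continuous_comp _ _ _ (tensor_app C) (fun y => dotv y y)).
    exact: continuous_tensor_app.
  exact: continuous_dotv.
have [z zZ zmin] := EVT_min_rV Zn0 cZ cg.
set g := dotv _ _ in zmin.
have g0 : 0 < g.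
  by rewrite lt_neqAle eq_sym dotv_eq0 dotv_ge0 Z0 //; rewrite inE in zZ.
set K := (\sum_t `|C t|) * (3 * B) ^+ k + 1.
have K0 : 0 < K.
  rewrite ltr_pwDr // mulr_ge0 ?sumr_ge0 // exprn_ge0 // mulr_ge0 //.
  rewrite le_max; apply/orP; left; rewrite inE in zZ.
  exact: le_trans (normr_ge0 _) (B1P _ zZ).
have kg0 : 0 < k%:R * g by rewrite mulr_gt0 // ltr0n.
(* With this step size the remainder d ^+ 2 * K is at most half of the first
   order decrease. *)
set d := Num.min 1 (k%:R * g / (2 * K)).
have d0 : 0 < d by rewrite lt_min ltr01 divr_gt0 // mulr_gt0.
have d1 : d <= 1 by rewrite ge_min lexx.
have dK : d * K <= k%:R * g / 2.
  have : d <= k%:R * g / (2 * K) by rewrite ge_min lexx orbT.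
  rewrite ler_pdivlMr ?mulr_gt0 // => h.
  rewrite ler_pdivlMr // -mulrA [K * 2]mulrC; exact: h.
exists d, (d * (k%:R * g / 2)); split => //; first by rewrite mulr_gt0 // divr_gt0.
move=> x Zx.
have xB : `|x| <= B by rewrite le_max B1P.
have gB : `|- tensor_app C x| <= B by rewrite normrN le_max B2P ?orbT.
have := @form_expansion C x (- tensor_app C x) B d k0 sC _ xB gB.
rewrite (ltW d0) d1 => /(_ isT).
rewrite scalerN; set gx := dotv _ (- _).
have gxE : gx = - dotv (tensor_app C x) (tensor_app C x).
  by rewrite /gx dotvN.
have : g <= dotv (tensor_app C x) (tensor_app C x) by apply: zmin; rewrite inE.
rewrite gxE; set q := dotv _ _ => gq h.
have h1 := le_trans (ler_norm _) h.
have h2 : d ^+ 2 * ((\sum_t `|C t|) * (3 * B) ^+ k) <= d * (d * K).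
  rewrite expr2 -mulrA ler_pM2l // ler_pM2l // /K; lra.
have h3 : d * (d * K) <= d * (k%:R * g / 2) by rewrite ler_pM2l.
have h4 : d * (k%:R * g) <= d * (k%:R * q) by rewrite !ler_pM2l // ltr0n.
move: h1 h2 h3 h4; rewrite !mulrN opprK; lra.
Qed.

End Forms.

(** * Testing the min-max values *)

Section WithinRows.
Context {R : realType} {V : normedModType R}.

Lemma within_continuous_coord {n} (A : set V) (f : V -> 'rV[R]_n) i :
  {within A, continuous f} -> {within A, continuous (fun x => f x ord0 i)}.
Proof.
move=> cf x; apply: (@continuous_comp (subspace A) _ _ f (fun y => y ord0 i)).
  exact: cf.
exact: coord_continuous.
Qed.

Lemma within_continuous_row_mx {m n} (A : set V) (f : V -> 'rV[R]_m) (g : V -> 'rV[R]_n) :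
  {within A, continuous f} -> {within A, continuous g} ->
  {within A, continuous (fun x => row_mx (f x) (g x))}.
Proof.
move=> cf cg; apply: within_continuous_row => i.
case: (split_ordP i) => j ->.
  by under eq_fun do rewrite row_mxEl; exact: within_continuous_coord.
by under eq_fun do rewrite row_mxEr; exact: within_continuous_coord.
Qed.

Lemma within_continuous_mulmx {m n} (A : set V) (f : V -> 'rV[R]_m) (M : 'M[R]_(m, n)) :
  {within A, continuous f} -> {within A, continuous (fun x => f x *m M)}.
Proof.
move=> cf x; apply: (@continuous_comp (subspace A) _ _ f (fun y => y *m M)).
  exact: cf.
exact: continuous_mulmx.
Qed.

End WithinRows.

Section OddMaps.
Context {R : realType}.

Lemma odd_maps_vanish_le {n} (S : set 'rV[R]_n) i j :
  (i <= j)%N -> odd_maps_vanish S j -> odd_maps_vanish S i.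
Proof. by move=> ij h s g si; apply: h; exact: leq_trans ij. Qed.

(** The quotient of the space by the row space of M has dimension n - c, so f
    and the class of h modulo the row space together form an odd map to a
    space of dimension less than i, which must vanish on S. *)
Lemma odd_maps_meet_rowspace {n r c i} (S : set 'rV[R]_n) (f : 'rV[R]_n -> 'rV[R]_r)
    (h : 'rV[R]_n -> 'rV[R]_n) (M : 'M[R]_(c, n)) :
  odd_maps_vanish S i -> row_free M -> (r + (n - c) < i)%N ->
  {within S, continuous f} -> (forall x, S x -> f (- x) = - f x) ->
  {within S, continuous h} -> (forall x, S x -> h (- x) = - h x) ->
  exists x, [/\ S x, f x = 0 & (h x <= M)%MS].
Proof.
move=> hS /eqP fM ri cf of' ch oh.
have rQ : (r + \rank (cokermx M) < i)%N by rewrite mxrank_coker fM.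
have [||x Sx] := hS _ (fun x => row_mx (f x) (h x *m col_base (cokermx M))) rQ.
- by apply: within_continuous_row_mx => //; exact: within_continuous_mulmx.
- by move=> x Sx; rewrite of' // oh // mulNmx opp_row_mx.
rewrite -row_mx0 => /eq_row_mx[fx hx]; exists x; split=> //.
by rewrite submxE -(mulmx_base (cokermx M)) mulmxA hx mul0mx.
Qed.

Lemma row_free_pivot {c n} (M : 'M[R]_(c, n)) (p : 'I_c -> 'I_n) :
  (forall i, M i (p i) != 0) -> (forall i j, i != j -> M i (p j) = 0) -> row_free M.
Proof.
move=> Mp M0; apply: inj_row_free => v vM; apply/rowP => j.
have : (v *m M) ord0 (p j) = 0 by rewrite vM mxE.
rewrite !mxE (bigD1 j) //= big1 ?addr0 => [/eqP|i ij]; last by rewrite M0 ?mulr0.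
by rewrite mulf_eq0 (negbTE (Mp j)) orbF => /eqP.
Qed.

End OddMaps.

Section MinMax.
Context {R : realType} {k n : nat}.
Implicit Types (A D : tensor R k n) (S : set 'rV[R]_n).

(** The conditions on the competing sets, apart from the genus. *)
Definition admissible S := [/\ S !=set0, compact S, symmetric_set S & ~ S 0].

Lemma minmax_le A D S i (b : \bar R) : admissible S -> odd_maps_vanish S i ->
  (forall x, S x -> ((rayleigh A D x)%:E <= b)%E) -> (minmax_eigenvalue A D i <= b)%E.
Proof.
move=> [S0 cS sS S00] vS hb; apply: ge_ereal_inf.
exists (ereal_sup [set (rayleigh A D x)%:E | x in S]).
  by exists S => //; split => //; apply/genus_geP.
by apply: ge_ereal_sup => _ [x Sx <-]; exact: hb.
Qed.

Lemma minmax_ge A D i (b : R) :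
  (forall S, admissible S -> odd_maps_vanish S i ->
    exists2 x, S x & b <= rayleigh A D x) ->
  (b%:E <= minmax_eigenvalue A D i)%E.
Proof.
move=> h; apply: le_ereal_inf_tmp => _ [S [S0 cS sS S00 gS] <-].
have [x Sx bx] := h S (And4 S0 cS sS S00) ((genus_geP _ S0).1 gS).
by apply: le_ereal_sup_tmp; exists (rayleigh A D x)%:E; [exists x | rewrite lee_fin].
Qed.

Lemma minmax_adherent A D i (lam e : R) : minmax_eigenvalue A D i = lam%:E -> 0 < e ->
  exists S, [/\ admissible S, odd_maps_vanish S i &
    forall x, S x -> rayleigh A D x <= lam + e].
Proof.
move=> mm e0.
have fin : minmax_eigenvalue A D i \is a fin_num by rewrite mm.
have [_ [S [S0 cS sS S00 gS] <-]] := lb_ereal_inf_adherent e0 fin.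
rewrite -/(minmax_eigenvalue A D i) mm => h; exists S; split => //.
  exact/(genus_geP _ S0).
move=> x Sx; rewrite -lee_fin EFinD; apply: le_trans (ltW h).
by apply: ereal_sup_ubound; exists x.
Qed.

End MinMax.

(** * Linear spaces on which the pencil vanishes *)

Lemma unit_dotv_norm {R : realType} {n : nat} (x : 'rV[R]_n) : dotv x x = 1 -> `|x| <= 1.
Proof.
move=> x1; apply: norm_coord_le => // i.
rewrite -(@expr_le1 _ 2) // -normrX ger0_norm ?sqr_ge0 // -x1 /dotv (bigD1 i) //= -expr2.
by rewrite lerDl sumr_ge0 // => j _; rewrite -expr2 sqr_ge0.
Qed.

Section DiagonalForm.
Context {R : realType} {k n : nat} (D : tensor R k n).
Hypotheses (k_pos : (0 < k)%N) (k_even : ~~ odd k).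
Hypothesis D_diag : positive_diagonal_tensor D.

Lemma constant_tuple (t : k.-tuple 'I_n) :
  constant t -> exists i, t = [tuple of nseq k i].
Proof.
case: t => -[|i s] ss /=; first by exfalso; move: k_pos; rewrite -(eqP ss).
move=> cs; exists i; apply: val_inj => /=; rewrite -(eqP ss) /=.
by congr (_ :: _); apply/all_pred1P.
Qed.

Lemma diagonal_symmetric : symmetric_tensor D.
Proof.
have nseqE i (t : k.-tuple 'I_n) : perm_eq [tuple of nseq k i] t ->
    t = [tuple of nseq k i].
  move=> pt; apply: val_inj => /=.
  have /all_pred1P -> : all (pred1 i) t.
    by apply/allP => j; rewrite -(perm_mem pt) => /nseqP[-> _] /=.
  by rewrite size_tuple.
move=> s t st; case: D_diag => D0 _.
have [/constant_tuple[i si]|ns] := boolP (constant s).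
  by rewrite si in st *; rewrite (nseqE i t st).
rewrite !D0 //; apply: contra ns => /constant_tuple[i ti].
by rewrite (nseqE i s) ?constant_nseq // -ti perm_sym.
Qed.

(** The form is the sum of the d_i x_i^k, where d_i > 0 and k is even. *)
Lemma diagonal_form_gt0 x : x != 0 -> 0 < form D x.
Proof.
move=> x0; rewrite formE //.
have nn (t : k.-tuple 'I_n) : 0 <= D t * \prod_(j <- t) x ord0 j.
  case: D_diag => D0 Dp; have [/constant_tuple[i ->]|/D0 ->] := boolP (constant t).
    rewrite mulr_ge0 ?(ltW (Dp i)) // big_nseq.
    by rewrite -Monoid.iteropE exprn_even_ge0.
  by rewrite mul0r.
have [i xi] : exists i, x ord0 i != 0.
  apply: contrapT => h; move/eqP: x0; apply; apply/rowP => i; rewrite mxE.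
  by apply: contrapT => /eqP xi; apply: h; exists i.
rewrite (bigD1 [tuple of nseq k i]) //= ltr_pwDl ?sumr_ge0 //.
case: D_diag => _ Dp; rewrite mulr_gt0 // big_nseq -Monoid.iteropE.
by rewrite exprn_even_gt0 // xi orbT.
Qed.

End DiagonalForm.

Section SpectralBounds.
Context {R : realType} {k n : nat} (A D : tensor R k n).
Hypotheses (k_pos : (0 < k)%N) (k_even : ~~ odd k).
Hypotheses (A_sym : symmetric_tensor A) (D_diag : positive_diagonal_tensor D).
Variable lam : R.

(** Eigenvectors for lam are the critical points of the form of A - lam D, and
    the Rayleigh quotient exceeds lam exactly where this form is positive. *)
Definition pencil : tensor R k n := fun t => A t - lam * D t.

Lemma pencil_symmetric : symmetric_tensor pencil.
Proof.
move=> s t st.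
by rewrite /pencil (A_sym st) (diagonal_symmetric k_pos D_diag st).
Qed.

Lemma pencil_app x : tensor_app pencil x = tensor_app A x - lam *: tensor_app D x.
Proof.
apply/rowP => i; rewrite !mxE mulr_sumr -sumrB; apply: eq_bigr => t _.
by rewrite /pencil; ring.
Qed.

Lemma eigenpairE x : x != 0 -> H_eigenpair A D lam x <-> tensor_app pencil x = 0.
Proof.
move=> x0; rewrite pencil_app; split=> [[_ ->]|/eqP]; first by rewrite subrr.
by rewrite subr_eq0 => /eqP.
Qed.

Lemma form_pencil x : form pencil x = form A x - lam * form D x.
Proof.
rewrite !formE // mulr_sumr -sumrB; apply: eq_bigr => t _.
by rewrite /pencil; ring.
Qed.

Lemma rayleighE x : x != 0 -> rayleigh A D x = lam + form pencil x / form D x.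
Proof.
move=> x0; have D0 : form D x != 0 by rewrite gt_eqF // diagonal_form_gt0.
rewrite /rayleigh -!/(form _ x) form_pencil.
by field.
Qed.

Definition gradient_step (d : R) x := x - d *: tensor_app pencil x.

Lemma gradient_step_opp d x : gradient_step d (- x) = - gradient_step d x.
Proof. by rewrite /gradient_step tensor_app_opp // scalerN opprB opprK addrC. Qed.

Lemma continuous_gradient_step d : continuous (gradient_step d).
Proof.
move=> x; apply: (@cvgB R _ _ (nbhs x)); first exact: cvg_id.
apply: (@cvgZ R _ _ (nbhs x)); first exact: cvg_cst.
exact: continuous_tensor_app.
Qed.

Lemma closed_zeros r (f : 'rV[R]_n -> 'rV[R]_r) :
  continuous f -> closed [set x | f x = 0].
Proof.
move=> cf; have -> : [set x | f x = 0] = f @^-1` [set 0] by [].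
apply: closed_comp; first by move=> x _; exact: cf.
exact: (compact_closed (@norm_hausdorff _ _) (@compact_set1 _ 0)).
Qed.

(** By definition of the multiplicity, the eigenvectors admit an odd map to the
    unit sphere of dimension r - 1; extended to the whole space it stays away
    from 0 on the eigenvectors in S, so its zeros in S are not critical. *)
Lemma eigenvector_detector r (S : set 'rV[R]_n) :
  multiplicity A D lam = (r%:R)%:E -> compact S -> symmetric_set S -> ~ S 0 ->
  exists f : 'rV[R]_n -> 'rV[R]_r, [/\ continuous f, forall x, f (- x) = - f x &
    forall x, S x -> f x = 0 -> tensor_app pencil x != 0].
Proof.
move=> /genus_attained[f0 [cf0 of0 f01]] cS sS S0.
have Sn0 x : S x -> x != 0 by move=> Sx; apply/eqP => x0; apply: S0; rewrite -x0.
set C := S `&` [set x | tensor_app pencil x = 0].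
have CK x : C x -> H_eigenpair A D lam x.
  by move=> [Sx Cx]; apply/eigenpairE => //; exact: Sn0.
have clC : closed C.
  apply: closedI; first exact: (compact_closed (@norm_hausdorff _ _) cS).
  exact/closed_zeros/continuous_tensor_app.
have sC : symmetric_set C.
  by move=> x [Sx Cx]; split; [exact: sS | rewrite /= tensor_app_opp // Cx oppr0].
have [||x /CK|f [cf of' fE]] := @odd_continuous_extension R n r C f0 1 clC sC.
- exact: continuous_subspaceW CK cf0.
- by move=> x /CK; exact: of0.
- by move=> /f01; exact: unit_dotv_norm.
exists f; split => // x Sx fx; apply/eqP => gx.
have Cx : C x by [].
have := f01 x (CK x Cx); rewrite -fE // fx => /eqP.
have /eqP -> : dotv (0 : 'rV[R]_r) 0 == 0 by rewrite dotv_eq0.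
by rewrite eq_sym oner_eq0.
Qed.

Lemma form_bound (S : set 'rV[R]_n) (C : tensor R k n) : compact S ->
  exists2 B, 0 < B & forall x, S x -> form C x <= B.
Proof.
move=> cS.
have [S0|/set0P/negP/negPn/eqP->] := pselect (S !=set0); last by exists 1.
have cn : {within S, continuous (form C)} by exact/continuous_subspaceT/continuous_form.
have [c _ cmax] := EVT_max_rV S0 cS cn.
exists (Num.max 1 (form C c)); first by rewrite lt_max ltr01.
by move=> x Sx; rewrite le_max cmax ?orbT // inE.
Qed.

(** If c >= i + r, the zeros Z of the detector on the sphere of the row space
    have genus at least c - r >= i: an odd map from Z to a space of dimension
    s < i extends, and with the detector it gives an odd map to a space of
    dimension r + s < c, which vanishes somewhere by the Borsuk-Ulam theorem.
    On Z the form of the pencil is 0 and has no critical point, so one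
    gradient step moves Z to a set of genus at least i on which the Rayleigh
    quotient is bounded by a number less than lam, a contradiction. *)
Lemma isotropic_dim_upper c i r (M : 'M[R]_(c, n)) : (0 < i)%N ->
  minmax_eigenvalue A D i = lam%:E -> multiplicity A D lam = (r%:R)%:E ->
  row_free M -> (forall x, (x <= M)%MS -> form pencil x = 0) -> (c < i + r)%N.
Proof.
move=> i0 mm mr fM M0; rewrite ltnNge; apply/negP => irc.
set S := linear_sphere M.
have cS : compact S := compact_linear_sphere (M := M).
have sS : symmetric_set S by move=> x; exact: linear_sphere_opp.
have S00 : ~ S 0 := linear_sphere_neq0 fM.
have [f [cf of' fN]] := eigenvector_detector mr cS sS S00.
set Z := S `&` [set x | f x = 0].
have clZ0 := closed_zeros cf.
have cZ : compact Z by exact: compact_closedI.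
have clZ : closed Z by exact: (compact_closed (@norm_hausdorff _ _) cZ).
have sZ : symmetric_set Z.
  by move=> x [Sx fx]; split; [exact: sS | rewrite /= of' fx oppr0].
have vZ : odd_maps_vanish Z i.
  move=> s g si cg og.
  have [B _ gB] : exists2 B, 0 < B & forall x, Z x -> `|g x| <= B.
    have cgZ : compact (g @` Z) by exact: continuous_compact.
    have [B [Breal BP]] := compact_bounded cgZ.
    exists (`|B| + 1); first by rewrite ltr_pwDr.
    move=> x Zx; apply: (BP (`|B| + 1)); last by exists x.
    by rewrite (le_lt_trans (ler_norm B)) // ltrDl.
  have [h [ch oh hg]] := odd_continuous_extension clZ sZ cg og gB.
  have rs : (r + s < c)%N by lia.
  have [||x Sx] := @linear_sphere_odd_maps_vanish R c n M _
    (fun x => row_mx (f x) (h x)) rs.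
  - by apply: within_continuous_row_mx; apply: continuous_subspaceT.
  - by move=> x _; rewrite of' oh opp_row_mx.
  rewrite -row_mx0 => /eq_row_mx[fx hx]; exists x; first by [].
  by rewrite -hg.
have [d [mu [d0 mu0 dec]]] := gradient_step_decrease k_pos pencil_symmetric cZ
  (fun x Zx => fN x Zx.1 Zx.2).
set S' := gradient_step d @` Z.
have cs : {within Z, continuous (gradient_step d)}.
  exact/continuous_subspaceT/continuous_gradient_step.
have S'neg y : S' y -> form pencil y <= - mu.
  move=> [x Zx <-]; apply: le_trans (dec x Zx) _.
  by rewrite M0 ?sub0r //; apply: linear_sphere_sub; exact: Zx.1.
have S'0 y : S' y -> y != 0.
  move=> /S'neg; apply: contraTneq => ->.
  rewrite -ltNge; suff -> : form pencil (0 : 'rV[R]_n) = 0 by rewrite oppr_lt0.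
  by rewrite -(scale0r (0 : 'rV[R]_n)) formZ // expr0n gtn_eqF // mul0r.
have cS' : compact S' by exact: continuous_compact.
have adm : admissible S'.
  split => //.
  - have [x Zx _] := vZ 0 (fun=> 0) i0 (fun x => cvg_cst _) (fun x _ => esym (oppr0 _)).
    by exists (gradient_step d x); exists x.
  - by move=> y [x Zx <-]; exists (- x); [exact: sZ | rewrite gradient_step_opp].
  - by move=> /S'0; rewrite eqxx.
have vS' : odd_maps_vanish S' i.
  by apply: odd_maps_vanish_image => // x _; exact: gradient_step_opp.
have [B B0 BP] := form_bound D cS'.
have : (minmax_eigenvalue A D i <= (lam - mu / B)%:E)%E.
  apply: minmax_le adm vS' _ => x S'x; rewrite lee_fin rayleighE ?S'0 // lerD2l.
  have Dx := diagonal_form_gt0 k_pos k_even D_diag (S'0 x S'x).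
  rewrite ler_pdivrMr // mulNr; apply: le_trans (S'neg x S'x) _.
  by rewrite lerN2 mulrAC ler_pdivrMr // ler_pM2l // BP.
by rewrite mm lee_fin lerDl oppr_ge0 leNgt divr_gt0.
Qed.

(** If r + (n - c) < i, take a competing set T on which the Rayleigh quotient
    is at most lam + e.  The detector and the class modulo the row space of the
    gradient step, both precomposed with the normalization, have a common zero
    in T.  At the corresponding unit vector z the pencil form is O(e), it drops
    by a fixed amount mu under the gradient step because z is not critical,
    and yet the step lands in the row space, where the form vanishes: this is
    impossible for small e. *)
Lemma isotropic_dim_lower c i r (M : 'M[R]_(c, n)) :
  minmax_eigenvalue A D i = lam%:E -> multiplicity A D lam = (r%:R)%:E ->
  row_free M -> (forall x, (x <= M)%MS -> form pencil x = 0) -> (i <= r + (n - c))%N.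
Proof.
move=> mm mr fM M0; rewrite leqNgt; apply/negP => rci.
set S := [set x : 'rV[R]_n | dotv x x = 1].
have clS : closed S.
  have -> : S = (fun x => dotv x x) @^-1` [set 1] by [].
  by apply: closed_comp; [move=> x _; exact: continuous_dotv | exact: closed_eq].
have cS : compact S.
  apply: bounded_closed_compact => //.
  exists 1; split => // B B1 x Sx; apply: le_trans (ltW B1).
  exact: unit_dotv_norm.
have sS : symmetric_set S by move=> x; rewrite /S /= dotv_opp.
have S00 : ~ S 0.
  rewrite /S /=; have /eqP -> : dotv (0 : 'rV[R]_n) 0 == 0 by rewrite dotv_eq0.
  by move/eqP; rewrite eq_sym oner_eq0.
have [f [cf of' fN]] := eigenvector_detector mr cS sS S00.
set Z := S `&` [set x | f x = 0].
have cZ : compact Z by apply: compact_closedI => //; exact: closed_zeros.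
have [d [mu [d0 mu0 dec]]] := gradient_step_decrease k_pos pencil_symmetric cZ
  (fun x Zx => fN x Zx.1 Zx.2).
have [B B0 BP] := form_bound D cS.
(* B bounds the form of D on the unit sphere, so that the pencil form at the
   unit vector below is at most mu / 2. *)
have e0 : 0 < mu / (2 * B) by rewrite divr_gt0 // mulr_gt0.
have [T [[_ _ sT T00] vT Tle]] := minmax_adherent mm e0.
have Tn0 x : T x -> x != 0 by move=> Tx; apply/eqP => x0; apply: T00; rewrite -x0.
have cn : {within T, continuous (@normalize R n)}.
  apply/subspace_continuousP => x Tx; apply: cvg_within_filter.
  by apply: continuous_normalize; exact: Tn0.
have [||||x [Tx fx hx]] := @odd_maps_meet_rowspace R n r c i T (f \o @normalize R n)
    (gradient_step d \o @normalize R n) M vT fM rci.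
- by move=> x; apply: (@continuous_comp (subspace T)); [exact: cn | exact: cf].
- by move=> x _; rewrite /= normalize_opp of'.
- move=> x; apply: (@continuous_comp (subspace T)); first exact: cn.
  exact: continuous_gradient_step.
- by move=> x _; rewrite /= normalize_opp gradient_step_opp.
set z := normalize x in fx hx.
have Sz : S z by rewrite /S /= dotv_normalize // Tn0.
have := dec z (conj Sz fx); rewrite -/(gradient_step d z) M0 //.
rewrite subr_ge0 leNgt => /negP; apply.
have x0 := Tn0 x Tx.
have Dx := diagonal_form_gt0 k_pos k_even D_diag x0.
have Fx : form pencil x <= mu / (2 * B) * form D x.
  by have := Tle x Tx; rewrite rayleighE // lerD2l ler_pdivrMr.
have Fz : form pencil z <= mu / (2 * B) * form D z.
  rewrite /z /normalize !formZ // mulrCA; apply: ler_wpM2l; last exact: Fx.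
  by rewrite exprn_ge0 // invr_ge0 sqrtr_ge0.
apply: le_lt_trans Fz _; rewrite mulrAC ltr_pdivrMr ?mulr_gt0 // ltr_pM2l //.
by have := BP z Sz; lra.
Qed.

End SpectralBounds.

(** * Independent sets and components of the support *)

Section IndependentSets.
Context {R : realType} {k n : nat} (E : {set {set 'I_n}}) (A D : tensor R k n).
Hypotheses (k_pos : (0 < k)%N) (k_even : ~~ odd k).
Hypothesis A_adj : adjacency_tensor E A.
Variable U : {set 'I_n}.
Hypothesis U_indep : independent E U.

Definition coordinate_rows : 'M[R]_(#|U|, n) := \matrix_(i, j) (j == enum_val i)%:R.

Lemma coordinate_rows_free : row_free coordinate_rows.
Proof.
apply: (@row_free_pivot _ _ _ _ (fun i => enum_val i)) => [i|i j ij]; rewrite mxE.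
  by rewrite eqxx oner_eq0.
by rewrite (inj_eq enum_val_inj) eq_sym (negbTE ij).
Qed.

(** Each monomial of A is indexed by a hyperedge, which is not contained in U
    and hence contributes a factor that vanishes on vectors supported in U. *)
Lemma coordinate_rows_form x : (x <= coordinate_rows)%MS -> form A x = 0.
Proof.
move=> /submxP[u ->]; rewrite formE // big1 // => t _.
case: A_adj => A0 _ At; have := A0 t; rewrite le_eqVlt => /predU1P[<-|/At tE].
  by rewrite mul0r.
have : ~~ ([set j in t]%SET \subset U) by move/forall_inP: U_indep; apply.
case/subsetPn => j; rewrite inE => jt jU.
suff uj : (u *m coordinate_rows) ord0 j = 0.
  have /eqP -> : \prod_(l <- t) (u *m coordinate_rows) ord0 l == 0.
    by rewrite prodf_seq_eq0; apply/hasP; exists j; rewrite //= uj.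
  by rewrite mulr0.
rewrite mxE big1 // => i _; rewrite mxE.
case: eqP => [ji|_]; last by rewrite mulr0.
by move: jU; rewrite ji enum_valP.
Qed.

Lemma coordinate_rows_rayleigh x : (x <= coordinate_rows)%MS -> rayleigh A D x = 0.
Proof. by move=> /coordinate_rows_form h; rewrite /rayleigh -/(form A x) h mul0r. Qed.

(** The sphere of the vectors supported in U is a competing set of genus #|U|
    on which the Rayleigh quotient is 0. *)
Lemma minmax_le0 i : (0 < i)%N -> (i <= #|U|)%N -> (minmax_eigenvalue A D i <= 0)%E.
Proof.
move=> i0 iU; apply: (@minmax_le _ _ _ A D (linear_sphere coordinate_rows)).
- split.
  + by apply: linear_sphere_nonempty; exact: leq_trans i0 iU.
  + exact: compact_linear_sphere.
  + by move=> x; exact: linear_sphere_opp.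
  + exact/linear_sphere_neq0/coordinate_rows_free.
- by apply: (odd_maps_vanish_le iU); exact: linear_sphere_odd_maps_vanish.
- by move=> x /linear_sphere_sub /coordinate_rows_rayleigh ->.
Qed.

(** The space of vectors supported in U has codimension n - #|U|, so it meets
    every set of larger genus. *)
Lemma minmax_ge0 i : (n - #|U| < i)%N -> (0 <= minmax_eigenvalue A D i)%E.
Proof.
move=> Ui; apply: minmax_ge => S _ vS.
have idc : {within S, continuous (fun x : 'rV[R]_n => x)}.
  by apply: continuous_subspaceT => x; apply: cvg_id.
have zc : {within S, continuous (fun x : 'rV[R]_n => 0 : 'rV[R]_0)}.
  by move=> x; exact: cvg_cst.
have oz x : S x -> (0 : 'rV[R]_0) = - 0 by rewrite oppr0.
have [x [Sx _ xU]] := @odd_maps_meet_rowspace R n 0 _ i S _ id _ vS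
  coordinate_rows_free Ui zc oz idc (fun x _ => erefl).
by exists x => //; rewrite coordinate_rows_rayleigh.
Qed.

End IndependentSets.

Section Components.
Context {R : realType} {k n : nat} (E : {set {set 'I_n}}) (A D : tensor R k n).
Hypotheses (k_pos : (0 < k)%N) (k_even : ~~ odd k).
Hypotheses (A_adj : adjacency_tensor E A) (D_diag : positive_diagonal_tensor D).
Variables (lam : R) (x : 'rV[R]_n).
Hypothesis x_eigen : H_eigenpair A D lam x.

Let adj := supp_adj E x.

Lemma supp_adj_connect_sym : connect_sym adj.
Proof.
apply: sym_connect_sym => u v; rewrite /adj /supp_adj andbCA.
by congr [&& _, _ & _]; apply: eq_existsb => e; rewrite [in RHS](andbC (v \in e)).
Qed.

(** One representative vertex for each component of the support. *)
Definition component_roots := [set v in supp x | roots adj v].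

Lemma card_component_roots : #|component_roots| = nb_supp_components E x.
Proof. by rewrite /nb_supp_components; apply: eq_card => v; rewrite !inE andbC. Qed.

(** The restrictions of x to the components of its support. *)
Definition component_rows : 'M[R]_(#|component_roots|, n) :=
  \matrix_(i, j) (x ord0 j *+ (fingraph.root adj j == enum_val i)).

Lemma component_rows_free : row_free component_rows.
Proof.
have P (i : 'I_#|component_roots|) :
    x ord0 (enum_val i) != 0 /\ fingraph.root adj (enum_val i) = enum_val i.
  by have := enum_valP i; rewrite !inE => /andP[? /eqP].
apply: (@row_free_pivot _ _ _ _ (fun i => enum_val i)) => [i|i j ij]; rewrite mxE (P _).2.
  by rewrite eqxx (P i).1.
by rewrite (inj_eq enum_val_inj) eq_sym (negbTE ij).
Qed.

(** A vector in the row space is obtained from x by rescaling each component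
    of the support by a factor kap.  A monomial that does not vanish at x is
    indexed by a constant tuple or by a hyperedge inside the support, thus by
    vertices of one component, so it is multiplied by the k-th power of one
    factor.  Grouped by the first index, the form becomes the sum of the
    kap_i^k x_i times the i-th entry of the eigenvector equation, which is 0. *)
Lemma component_rows_form y : (y <= component_rows)%MS -> form (pencil A D lam) y = 0.
Proof.
move=> /submxP[u ->]; set z := u *m _.
pose kap v := \sum_i u ord0 i *+ (fingraph.root adj v == enum_val i).
have zE v : z ord0 v = kap v * x ord0 v.
  rewrite mxE mulr_suml; apply: eq_bigr => i _; rewrite mxE.
  by case: (_ == _); rewrite ?mulr0n ?mulr0 ?mul0r.
have termE i (t : k.-tuple 'I_n) : ohead t == Some i ->
    pencil A D lam t * \prod_(j <- t) z ord0 j =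
    kap i ^+ k * (pencil A D lam t * \prod_(j <- t) x ord0 j).
  move=> ti; rewrite (eq_bigr _ (fun v _ => zE v)) big_split /=.
  have it : i \in val t.
    move: ti; rewrite [ohead _]/ohead -[val t]/(tval t).
    by case: (tval t) => // j s /eqP[->]; exact: mem_head.
  have kapE : (forall j, j \in val t -> fingraph.root adj j = fingraph.root adj i) ->
      \prod_(j <- t) kap j = kap i ^+ k.
    move=> h; rewrite big_seq (eq_bigr (fun=> kap i)) => [|j jt].
      by rewrite -big_seq big_const_seq count_predT size_tuple -Monoid.iteropE.
    by rewrite /kap h.
  have [x0|xn0] := eqVneq (\prod_(j <- t) x ord0 j) 0; first by rewrite x0 !mulr0.
  have tx j : j \in val t -> j \in supp x.
    move=> jt; rewrite inE; apply: contraNneq xn0 => xj.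
    by rewrite prodf_seq_eq0; apply/hasP; exists j; rewrite //= xj.
  have [ct|nt] := boolP (constant t).
    have [j tj] := constant_tuple k_pos ct.
    rewrite kapE; first by ring.
    move=> l; rewrite tj => /nseqP[-> _]; congr fingraph.root.
    by move: it; rewrite tj => /nseqP[].
  rewrite /pencil D_diag.1 // mulr0 subr0.
  case: A_adj => A0 _ At; have := A0 t; rewrite le_eqVlt => /predU1P[<-|/At tE].
    by rewrite !mul0r mulr0.
  rewrite kapE; first by ring.
  move=> j jt; apply/eqP; rewrite root_connect; last exact: supp_adj_connect_sym.
  apply: connect1; rewrite /adj /supp_adj !tx //=.
  by apply/exists_inP; exists [set j in t]%SET => //; rewrite !inE jt.
rewrite formE // -sum_by_head //.
rewrite big1 // => i _; rewrite (eq_bigr _ (fun t ti => termE i t ti)) -mulr_sumr.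
have x0 : x != 0 by case: x_eigen.
have /(eigenpairE A D lam x0) px := x_eigen.
suff -> : \sum_(t : k.-tuple 'I_n | ohead t == Some i)
    pencil A D lam t * \prod_(j <- t) x ord0 j =
    tensor_app (pencil A D lam) x ord0 i * x ord0 i.
  by rewrite px mxE mul0r mulr0.
rewrite mxE mulr_suml; apply: eq_bigr => -[[|j s] ss] //= /eqP[->].
by rewrite big_cons; ring.
Qed.

End Components.

Lemma leq_card_inj (a n : nat) (f : 'I_a -> 'I_n) (X : {set 'I_n}) :
  injective f -> (forall i, f i \in X) -> (a <= #|X|)%N.
Proof.
move=> inj fX; rewrite -[leqLHS]card_ord -(card_codom inj).
by apply/subset_leq_card/fintype.subsetP => _ /codomP[i ->].
Qed.

Theorem proposition1p2 (R : realType) (n k : nat) (E : {set {set 'I_n}})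
    (A D : tensor R k n)
    (k_pos : (0 < k)%N) (k_even : ~~ odd k)
    (E_uniform : uniform_hypergraph k E)
    (A_adj : adjacency_tensor E A)
    (D_diag : positive_diagonal_tensor D) :
  (independence_number E <=
     minn #|[set i : 'I_n | (minmax_eigenvalue A D i.+1 <= 0)%E]%SET|
          #|[set i : 'I_n | (0 <= minmax_eigenvalue A D i.+1)%E]%SET|)%N
  /\
  (forall (i r : nat) (lam : R) (x : 'rV[R]_n),
     (1 <= i <= n)%N ->
     minmax_eigenvalue A D i = lam%:E ->
     H_eigenpair A D lam x ->
     multiplicity A D lam = (r%:R)%:E ->
     (nb_supp_components E x <= minn (i + r - 1) (n - i + r))%N).
Proof.
split.
  apply/bigmax_leqP => U U_indep.
  have Un : (#|U| <= n)%N by rewrite -[leqRHS]card_ord max_card.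
  rewrite leq_min; apply/andP; split.
    have inj : injective (widen_ord Un) by move=> i j /(congr1 val) /= /val_inj.
    apply: (leq_card_inj inj) => i; rewrite inE.
    by apply: (minmax_le0 D k_pos A_adj U_indep) => //=; exact: ltn_ord.
  have inj : injective (@rev_ord n \o widen_ord Un).
    by move=> i j /rev_ord_inj /(congr1 val) /= /val_inj.
  apply: (leq_card_inj inj) => i; rewrite inE.
  apply: (minmax_ge0 D k_pos A_adj U_indep) => /=.
  by rewrite subnSK ?ltn_sub2l //; exact: leq_trans (ltn_ord i) Un.
move=> i r lam x /andP[i0 iN] mm xe mr.
have A_sym : symmetric_tensor A by case: A_adj.
have fM := component_rows_free E x.
have M0 := component_rows_form k_pos A_adj D_diag xe.
have := isotropic_dim_upper k_pos k_even A_sym D_diag i0 mm mr fM M0.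
have := isotropic_dim_lower k_pos k_even A_sym D_diag mm mr fM M0.
have : (#|component_roots E x| <= n)%N by rewrite -[leqRHS]card_ord max_card.
rewrite card_component_roots leq_min; lia.
Qed.
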